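(* Let $r\ge 2$, let $f=f^{(r)}(x_0,\dots,x_r)\in k[x_0,\dots,x_r]$ be the determinant of the generic sub-Hankel matrix $M^{(r)}(x_0,\dots,x_r)$, and let $J=(\partial f/\partial x_0,\dots,\partial f/\partial x_r)$. Then: (i) For every $i$ in the range $1\le i\le r-1$, the partial derivatives $\partial f/\partial x_0,\dots,\partial f/\partial x_i$ (which belong to $k[x_{r-i},\dots,x_r]$), divided by their greatest common divisor, define a Cremona transformation of $\mathbb{P}^i$; in addition, the base ideal of the inverse map is also a codimension two perfect ideal of linear type (as is the base ideal of the map itself), and both ideals are generated in degree $i$. (ii) The linear part of the graded presentation matrix of $J$ has maximal rank. (iii) The Hessian of $f$ has the form $h(f)=c\,x_r^{(r+1)(r-2)}$ with $c\in k$, $c\ne 0$. (iv) $f$ is homaloidal.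
   Context: $k$ is an algebraically closed field of characteristic $0$. For $r\ge1$, the generic sub-Hankel matrix $M^{(r)}(x_0,\dots,x_r)$ is the $r\times r$ matrix whose $(p,q)$ entry ($1\le p,q\le r$) is $x_{p+q-2}$ if $p+q-2\le r$ and $0$ otherwise. The Hessian $h(f)$ is the determinant of the $(r+1)\times(r+1)$ matrix of second partial derivatives of $f$. The form $f$ is homaloidal if its polar map $\phi_f=(\partial f/\partial x_0:\dots:\partial f/\partial x_r):\mathbb{P}^r\dashrightarrow\mathbb{P}^r$ is birational. A Cremona transformation of $\mathbb{P}^i$ is a birational map $\mathbb{P}^i\dashrightarrow\mathbb{P}^i$; its base ideal is the ideal generated by the forms of the same degree, without common factor, defining it. An ideal $I$ in a Noetherian ring $R$ is of linear type if the natural surjection from the symmetric algebra of $I$ to the Rees algebra of $I$ is injective. An ideal $I$ of a standard graded ring over a field is perfect if its homological (projective) dimension is finite and $R/I$ has the minimal possible projective dimension, namely the codimension of $I$ (over a polynomial ring: $R/I$ is Cohen–Macaulay). If $R$ is standard graded over $k$ and $I$ is generated by $n$ forms of degree $s$, with graded free presentation $R(-(s+1))^{\ell}\oplus\sum_{j\ge2}R(-(s+j))\xrightarrow{\varphi}R(-s)^n\to I\to0$, the linear part of $\varphi$ is the image of $R(-(s+1))^{\ell}$ under $\varphi$; the corresponding submatrix $\varphi_1$ has maximal rank if its rank is $n-1$ ($=\operatorname{rank}\varphi$). *)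

(* Defs.v *)
From HB Require Import structures.
From mathcomp Require Import all_boot all_order all_algebra.
From mathcomp Require Import mpoly.

Set Implicit Arguments.
Unset Strict Implicit.
Unset Printing Implicit Defensive.

Import GRing.Theory.

Local Open Scope ring_scope.

(* Ideals of R are handled as predicates R -> Prop, without decidability. *)

Section Ideals.
Variable R : comNzRingType.
Implicit Types I P : R -> Prop.

Definition ideal_gen (m : nat) (g : 'I_m -> R) : R -> Prop :=
  fun x => exists a : 'I_m -> R, x = \sum_(j < m) a j * g j.

Definition is_ideal I : Prop :=
  [/\ I 0, (forall x y, I x -> I y -> I (x + y))
    & (forall a x, I x -> I (a * x))].

Definition is_prime_ideal P : Prop :=
  [/\ is_ideal P, ~ P 1 & (forall x y, P (x * y) -> P x \/ P y)].

Definition subideal I P : Prop := forall x, I x -> P x.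

(* There is a chain of primes C 0 < C 1 < ... < C h = P. *)
Definition height_ge P (h : nat) : Prop :=
  exists C : nat -> R -> Prop,
    [/\ (forall j, (j <= h)%N -> is_prime_ideal (C j)),
        (forall j, (j < h)%N ->
           subideal (C j) (C j.+1) /\ ~ subideal (C j.+1) (C j))
      & (forall x, C h x <-> P x)].

Definition prime_height P (h : nat) : Prop :=
  height_ge P h /\ ~ height_ge P h.+1.

(* The codimension of I is the least height of a prime containing I. *)
Definition codim I (c : nat) : Prop :=
  (exists P, [/\ is_prime_ideal P, subideal I P & prime_height P c]) /\
  (forall P h, is_prime_ideal P -> subideal I P -> prime_height P h ->
     (c <= h)%N).

Definition projective (P : lmodType R) : Prop :=
  forall (M N : lmodType R) (g : {linear M -> N}) (f : {linear P -> N}),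
    (forall y, exists x, g x = y) ->
    exists f' : {linear P -> M}, forall x, g (f' x) = f x.

Definition proj_dim_le (M : lmodType R) (n : nat) : Prop :=
  exists (P : nat -> lmodType R) (eps : {linear P 0%N -> M})
         (d : forall j, {linear P j.+1 -> P j}),
    [/\ (forall j, projective (P j)) /\
        (forall j, (n < j)%N -> forall x : P j, x = 0),
        (forall y, exists x, eps x = y),
        (forall x, eps x = 0 <-> exists z, d 0%N z = x)
      & (forall j x, d j x = 0 <-> exists z, d j.+1 z = x)].

Definition proj_dim (M : lmodType R) (n : nat) : Prop :=
  proj_dim_le M n /\ forall m, proj_dim_le M m -> (n <= m)%N.

(* M is the quotient module R / I, via the projection pi. *)
Definition is_quotient I (M : lmodType R) (pi : {linear R^o -> M}) : Prop :=
  (forall y, exists x, pi x = y) /\ (forall x : R, pi x = 0 <-> I x).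

Definition perfect_of_codim I (c : nat) : Prop :=
  codim I c /\
  exists (M : lmodType R) (pi : {linear R^o -> M}),
    is_quotient I pi /\ proj_dim M c.

Definition is_sym_algebra (E : lmodType R) (S : comAlgType R)
    (iota : {linear E -> S}) : Prop :=
  forall (A : comAlgType R) (g : {linear E -> A}),
    exists h : {lrmorphism S -> A},
      (forall e, h (iota e) = g e) /\
      (forall h' : {lrmorphism S -> A},
         (forall e, h' (iota e) = g e) -> forall s, h' s = h s).

(* E, via inc, is the ideal I seen as an R-module.  The Rees algebra of I is
   the subalgebra R[It] of R[t], that is, the image of h; hence injectivity of
   h is injectivity of the natural surjection Sym(I) -> Rees(I). *)
Definition linear_type I : Prop :=
  exists (E : lmodType R) (inc : {linear E -> R^o})
         (S : comAlgType R) (iota : {linear E -> S})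
         (h : {lrmorphism S -> {poly R}}),
    [/\ injective inc /\ (forall x : R, I x <-> exists e, inc e = x),
        is_sym_algebra iota,
        (forall e, h (iota e) = (inc e : R) *: 'X)
      & injective h].

End Ideals.

Section CommonFactors.
Variable R : comUnitRingType.

Definition divides (a b : R) : Prop := exists u, b = a * u.

Definition is_gcd (m : nat) (p : 'I_m -> R) (D : R) : Prop :=
  (forall j, divides D (p j)) /\
  (forall E, (forall j, divides E (p j)) -> divides E D).

Definition no_common_factor (m : nat) (p : 'I_m -> R) : Prop :=
  forall E, (forall j, divides E (p j)) -> E \is a GRing.unit.

End CommonFactors.

Section RationalMaps.
Variables (k : fieldType) (n : nat).
Implicit Types F G : (n.+1).-tuple {mpoly k[n.+1]}.

(* A tuple of forms of the same degree, not all zero, represents a rational map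
   from P^n to P^n; proportional tuples represent the same map. *)
Definition rational_map (d : nat) F : Prop :=
  (forall j, tnth F j \is d.-homog) /\ (exists j, tnth F j != 0).

Definition same_map F G : Prop :=
  forall a b, tnth F a * tnth G b = tnth F b * tnth G a.

Definition compose G F : (n.+1).-tuple {mpoly k[n.+1]} :=
  [tuple tnth G j \mPo F | j < n.+1].

Definition id_map : (n.+1).-tuple {mpoly k[n.+1]} :=
  [tuple 'X_j | j < n.+1].

(* G after F is defined, and is the identity. *)
Definition left_inverse_map G F : Prop :=
  (exists j, tnth (compose G F) j != 0) /\ same_map (compose G F) id_map.

Definition inverse_maps F G : Prop :=
  left_inverse_map G F /\ left_inverse_map F G.

Definition cremona F : Prop :=
  exists d e G, [/\ rational_map d F, rational_map e G & inverse_maps F G].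

(* The forms F, of degree d, generate the base ideal of the map they define. *)
Definition base_forms (d : nat) F : Prop :=
  rational_map d F /\ no_common_factor (tnth F).

End RationalMaps.

Section Presentations.
Variables (k : fieldType) (N : nat).
Local Notation S := {mpoly k[N]}.

(* Rows are syzygies: phi1 stacks those of degree 1, and row c of phi2 has
   degree e c >= 2.  Relative to n forms g of one degree s, this is the exact
   sequence
     S(-(s+1))^l + sum_c S(-(s+e c)) -> S(-s)^n -> (g) -> 0. *)
Definition graded_presentation (n : nat) (g : 'I_n -> S)
    (l m : nat) (phi1 : 'M[S]_(l, n)) (e : 'I_m -> nat) (phi2 : 'M[S]_(m, n))
    : Prop :=
  [/\ (forall c j, phi1 c j \is 1.-homog),
      (forall c, (2 <= e c)%N),
      (forall c j, phi2 c j \is (e c).-homog)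
    & (forall v : 'rV[S]_n,
         v *m (\col_j g j) = 0 <->
         exists (a : 'rV[S]_l) (b : 'rV[S]_m), v = a *m phi1 + b *m phi2)].

(* A finite presentation exists as soon as the forms g are linearly independent
   over k (S is Noetherian); the linear part does not depend on its choice. *)
Definition linear_part_has_max_rank (n : nat) (g : 'I_n -> S) : Prop :=
  (forall a : 'I_n -> k, \sum_j a j *: g j = 0 -> forall j, a j = 0) /\
  (forall l m (phi1 : 'M[S]_(l, n)) (e : 'I_m -> nat) (phi2 : 'M[S]_(m, n)),
     graded_presentation g phi1 e phi2 ->
     \rank (map_mx (@FracField.tofrac S) phi1) = n.-1).

End Presentations.

Section SubHankel.
Variables (k : fieldType) (r : nat).

(* Rows and columns are numbered from 0. *)
Definition sub_hankel : 'M[{mpoly k[r.+1]}]_r :=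
  \matrix_(p, q) if (p + q <= r)%N then 'X_(inord (p + q)) else 0.

Definition sub_hankel_det : {mpoly k[r.+1]} := \det sub_hankel.

(* For i <= r, substituting these for y_0, ..., y_i identifies k[y_0, ..., y_i]
   with the subring k[x_(r-i), ..., x_r]. *)
Definition last_vars (i : nat) : (i.+1).-tuple {mpoly k[r.+1]} :=
  [tuple 'X_(inord (r - i + j)) | j < i.+1].

End SubHankel.

Section PolarMap.
Variables (k : fieldType) (n : nat).
Implicit Type f : {mpoly k[n.+1]}.

Definition polar_map f : (n.+1).-tuple {mpoly k[n.+1]} :=
  [tuple f^`M(j) | j < n.+1].

Definition homaloidal f : Prop := cremona (polar_map f).

Definition hessian f : {mpoly k[n.+1]} := \det (\matrix_(i, j) f^`M(i)^`M(j)).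

End PolarMap.

(* Main.v *)
(** With y_a = x_(r-a) and Y = sum_a y_a t^a, the determinant f is, up to sign,
    y_0^(r+1) [t^r] Y^(-1); hence for b < r the derivative of f in x_b is, up to a constant,
    y_0^(r+1) [t^b] Y^(-2). So the maps in (i) are Y |-> Y^(-2) and Z |-> Z^(-1/2) on
    truncated power series. The equation Y A' = -2 Y' A for A = Y^(-2) is a triangular
    system of bilinear equations
      L_n = sum_(a+b=n) (b + 2a) y_a A_b = 0   (n >= 1),
    which can be solved for A as well as for Y: this gives the linear syzygies, the inverse
    maps and, after differentiation, the Hessian.

    In k[y,T], the forms L_1(y,T), ..., L_i(y,T) together with y_0 form a regular sequence,
    by induction along exact sequences that split off the linear primes
    (y_0, ..., y_(m-1), T_0, ..., T_(l-1)). Inverting y_0 eliminates T_1, ..., T_i, so the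
    L_n generate the ideal of the Rees algebra: the base ideal is of linear type, and its
    Hilbert-Burch resolution is given by the L_n. *)

Require Import Defs.
From HB Require Import structures.
From mathcomp Require Import all_boot all_order all_algebra.
From mathcomp Require Import perm ring_quotient.
From mathcomp Require Import boolp.
From mathcomp Require Import mpoly.
From mathcomp Require Import zify ring.

Set Implicit Arguments.
Unset Strict Implicit.
Unset Printing Implicit Defensive.
Import GRing.Theory.
Local Open Scope ring_scope.

(** * Bilinear triangular systems *)

(** Exchanging y and A in L_n only transposes the integer weights, so a map and its inverse are
    handled by the same statements. Characteristic 0 makes the relevant weights invertible, and then
    L_n determines its last unknown as soon as y_0 is inverted. The weights b + 2a account only for
    L_n with n < r. The form L_r involves the derivative of f in x_r = y_0, where the factor
    y_0^(r+1) is differentiated too; there the weights become a - 1. Hence (i) uses L_1, ..., L_i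
    with i < r, while (ii), (iii) and (iv) need all r forms. Codimension and perfection quantify
    over all chains of primes and all projective resolutions, so the free resolution alone is not
    enough. Two further bounds are required: the height of (y_0, y_1) is at most 2, which rests on
    the Krull dimension of a polynomial ring, obtained by counting monomials; and no resolution of
    length one exists, even by modules that are projective but not free. *)

Section BilinearSystem.
Variable R : comNzRingType.
Implicit Types (c : nat -> nat -> int) (y A B : nat -> R).

(** The integer weights [c] stay general: b + 2a serves the maps in (i), [polar_coef] the full polar
    map, and the transposed weights their inverses. *)
Definition lform c y A (n : nat) : R :=
  \sum_(a < n.+1) (c a (n - a)%N)%:~R * (y a * A (n - a)%N).

Lemma lformC c y A n : lform c y A n = lform (fun a b => c b a) A y n.
Proof.
rewrite /lform (reindex_inj rev_ord_inj) /=; apply: eq_bigr => a _.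
by rewrite subSS subKn -1?ltnS // [y _ * _]mulrC.
Qed.

Lemma eq_lform c y y' A A' n :
  (forall a, (a <= n)%N -> y a = y' a) -> (forall a, (a <= n)%N -> A a = A' a) ->
  lform c y A n = lform c y' A' n.
Proof.
by move=> ey eA; apply: eq_bigr => a _; rewrite ey ?eA // ?leq_subr // -ltnS.
Qed.

Lemma lformB c y A B u v n :
  lform c y (fun b => u * A b - v * B b) n = u * lform c y A n - v * lform c y B n.
Proof.
by rewrite /lform !mulr_sumr -sumrB; apply: eq_bigr => a _; ring.
Qed.

Lemma lform_recl c y A n :
  lform c y A n = (c 0%N n)%:~R * (y 0%N * A n)
    + \sum_(a < n) (c a.+1 (n - a.+1)%N)%:~R * (y a.+1 * A (n - a.+1)%N).
Proof. by rewrite /lform big_ord_recl subn0. Qed.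

End BilinearSystem.

Lemma lform_morph (R S : comNzRingType) (f : {rmorphism R -> S}) c y A n :
  f (lform c y A n) = lform c (f \o y) (f \o A) n.
Proof.
by rewrite /lform rmorph_sum; apply: eq_bigr => a _; rewrite !rmorphM rmorph_int.
Qed.

Section Uniqueness.
Variables (R : idomainType) (c : nat -> nat -> int) (y : nat -> R) (i : nat).
Hypothesis y0 : y 0%N != 0.
Hypothesis c0 : forall n, (0 < n <= i)%N -> (c 0%N n)%:~R != 0 :> R.

Lemma lform_eq0 (A : nat -> R) :
  (forall n, (0 < n <= i)%N -> lform c y A n = 0) -> A 0%N = 0 ->
  forall n, (n <= i)%N -> A n = 0.
Proof.
move=> LA A0; elim/ltn_ind => -[//|n] IH le_n.
have := LA n.+1; rewrite lform_recl big1 ?addr0 => [|a _]; last first.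
  by rewrite IH ?mulr0 //; lia.
by move/(_ le_n)/eqP; rewrite !mulf_eq0 (negPf (c0 _)) // (negPf y0) => /eqP.
Qed.

(** Two solutions of one system represent the same rational map: A_0 B - B_0 A is again a solution,
    and it starts with 0. *)
Lemma lform_proportional (A B : nat -> R) :
  (forall n, (0 < n <= i)%N -> lform c y A n = 0) ->
  (forall n, (0 < n <= i)%N -> lform c y B n = 0) ->
  forall n, (n <= i)%N -> A 0%N * B n = B 0%N * A n.
Proof.
move=> LA LB n le_n; apply/eqP; rewrite -subr_eq0; apply/eqP.
apply: (lform_eq0 (A := fun b => A 0%N * B b - B 0%N * A b)) le_n => [m m_i|].
  by rewrite lformB LA // LB // !mulr0 subr0.
by rewrite mulrC subrr.
Qed.

End Uniqueness.

Section GenericSolution.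
Variables (k : fieldType) (N : nat) (c : nat -> nat -> int).
Variable y : nat -> {mpoly k[N]}.

(** Course-of-values recursion: the list carries all earlier values. The new entry solves the
    equation of index m + 1 for its last unknown, the powers of y_0 clearing the denominators. *)
Fixpoint esols (n : nat) : seq {mpoly k[N]} :=
  if n is m.+1 then
    rcons (esols m) (- (c 0%N m.+1)%:~R^-1 *: \sum_(a < m.+1)
      (c a.+1 (m - a)%N)%:~R * (y a.+1 * y 0%N ^+ a * (esols m)`_(m - a)))
  else [:: 1].

(* When [lform c y A n = 0] is the equation Y A' = alpha Y' A on power series, [esol n] is
   y_0^n times the coefficient of t^n in (Y / y_0)^alpha. *)
Definition esol n := (esols n)`_n.

Lemma size_esols n : size (esols n) = n.+1.
Proof. by elim: n => //= n IH; rewrite size_rcons IH. Qed.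

Lemma nth_esols n m : (m <= n)%N -> (esols n)`_m = esol m.
Proof.
elim: n => [|n IH]; first by rewrite leqn0 => /eqP->.
rewrite leq_eqVlt => /predU1P[->//|lt_mn] /=.
by rewrite nth_rcons size_esols lt_mn IH.
Qed.

Lemma esol0 : esol 0 = 1. Proof. by []. Qed.

Lemma esolS n :
  esol n.+1 = - (c 0%N n.+1)%:~R^-1 *: \sum_(a < n.+1)
      (c a.+1 (n - a)%N)%:~R * (y a.+1 * y 0%N ^+ a * esol (n - a)).
Proof.
rewrite /esol /= nth_rcons size_esols ltnn eqxx; congr (_ *: _).
by apply: eq_bigr => a _; rewrite nth_esols ?leq_subr.
Qed.

(** The solution with A_0 = y_0^i: this power of y_0 clears all denominators up to index i and gives
    every entry the degree i. *)
Definition asol (i n : nat) := y 0%N ^+ (i - n) * esol n.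

Lemma asol0 i : asol i 0 = y 0%N ^+ i.
Proof. by rewrite /asol subn0 mulr1. Qed.

Lemma mpolyC_int (z : int) : (z%:~R)%:MP_[N] = z%:~R :> {mpoly k[N]}.
Proof. exact: (rmorph_int (@mpolyC N k)). Qed.

Hypothesis c0 : forall n, (0 < n)%N -> (c 0%N n)%:~R != 0 :> k.

Lemma lform_asol i n : (0 < n <= i)%N -> lform c y (asol i) n = 0.
Proof.
case: n => // n /= lt_ni.
rewrite lform_recl /asol esolS -mul_mpolyC.
set s := (X in _%:MP * X).
have -> : \sum_(a < n.+1) (c a.+1 (n.+1 - a.+1)%N)%:~R *
    (y a.+1 * (y 0%N ^+ (i - (n.+1 - a.+1)) * esol (n.+1 - a.+1)%N)) =
    y 0%N ^+ (i - n) * s.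
  rewrite mulr_sumr; apply: eq_bigr => -[a /= lt_an] _; rewrite subSS.
  have -> : (i - (n - a) = i - n + a)%N by lia.
  by rewrite exprD; ring.
have -> : (i - n = (i - n.+1).+1)%N by lia.
have e : (c 0%N n.+1)%:~R * (- (c 0%N n.+1)%:~R^-1 : k)%:MP = -1 :> {mpoly k[N]}.
  by rewrite -mpolyC_int -mpolyCM mulrN mulfV ?c0 // mpolyCN.
rewrite exprS; ring: e.
Qed.

Lemma esol_homog : (forall a, y a \is 1.-homog) -> forall n, esol n \is n.-homog.
Proof.
move=> hy; elim/ltn_ind => -[|n] IH; first by rewrite esol0 dhomog1.
rewrite esolS; apply: dhomogZ; apply: rpred_sum => -[a /= lt_an] _.
rewrite -mpolyC_int mul_mpolyC; apply: dhomogZ.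
have -> : n.+1 = (1 + 1 * a + (n - a))%N by lia.
by apply: dhomogM; [apply: dhomogM => //; apply: dhomogMn | apply: IH; lia].
Qed.

Lemma asol_homog i n : (forall a, y a \is 1.-homog) -> (n <= i)%N ->
  asol i n \is i.-homog.
Proof.
move=> hy le_ni; have -> : i = (1 * (i - n) + n)%N by lia.
rewrite /asol (_ : (_ - _ = i - n)%N); last by lia.
by apply: dhomogM; [apply: dhomogMn | apply: esol_homog].
Qed.

(** In the recursion only the term a = 0 is free of y_0. This gives both the coprimality of the
    first and last forms and the primes over the base ideal. *)
Lemma esol_mod_y0 : (forall n, (c 1%N n)%:~R != 0 :> k) ->
  forall n, exists u g, u != 0 /\ esol n = u *: y 1%N ^+ n + y 0%N * g.
Proof.
move=> c1; elim=> [|n [u [g [u0 e]]]].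
  by exists 1, 0; rewrite oner_neq0 esol0 mulr0 addr0 scale1r.
exists (- (c 0%N n.+1)%:~R^-1 * (c 1%N n)%:~R * u).
have [S eS] : exists S, \sum_(a < n) (c a.+2 (n - a.+1)%N)%:~R *
    (y a.+2 * y 0%N ^+ a.+1 * esol (n - a.+1)) = y 0%N * S.
  exists (\sum_(a < n) (c a.+2 (n - a.+1)%N)%:~R *
    (y a.+2 * y 0%N ^+ a * esol (n - a.+1))).
  by rewrite mulr_sumr; apply: eq_bigr => a _; rewrite exprS; ring.
exists (- (c 0%N n.+1)%:~R^-1 *: ((c 1%N n)%:~R * (y 1%N * g) + S)).
split; first by rewrite !mulf_neq0 // oppr_eq0 invr_eq0 c0.
rewrite esolS big_ord_recl subn0 e eS -!mul_mpolyC -mpolyC_int !mpolyCM.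
by rewrite exprS; ring.
Qed.

End GenericSolution.

(** * Mutually inverse rational maps from one bilinear system *)

Section InverseMaps.
Variables (k : fieldType) (i : nat) (c : nat -> nat -> int).
Local Notation R := {mpoly k[i.+1]}.

(** Since y_a = x_(i-a), source coordinates are numbered downwards and target coordinates upwards;
    so F is read upwards and its inverse G downwards. *)
Definition var_up (b : nat) : R := 'X_(inord b).
Definition var_down (a : nat) : R := 'X_(inord (i - a)).

Definition map_up (F : i.+1.-tuple R) (b : nat) := tnth F (inord b).
Definition map_down (F : i.+1.-tuple R) (a : nat) := tnth F (inord (i - a)).

Lemma map_up_ord F (j : 'I_i.+1) : map_up F j = tnth F j.
Proof. by rewrite /map_up inord_val. Qed.

Lemma map_down_ord F (j : 'I_i.+1) : map_down F (i - j) = tnth F j.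
Proof. by rewrite /map_down subKn ?inord_val // -ltnS. Qed.

Lemma var_up_ord (j : 'I_i.+1) : var_up j = 'X_j.
Proof. by rewrite /var_up inord_val. Qed.

Lemma var_down_ord (j : 'I_i.+1) : var_down (i - j) = 'X_j.
Proof. by rewrite /var_down subKn ?inord_val // -ltnS. Qed.

Lemma comp_var_up (F : i.+1.-tuple R) b : var_up b \mPo F = map_up F b.
Proof. by rewrite /var_up comp_mpolyXU -tnth_nth. Qed.

Lemma comp_var_down (F : i.+1.-tuple R) a : var_down a \mPo F = map_down F a.
Proof. by rewrite /var_down comp_mpolyXU -tnth_nth. Qed.

Lemma mpolyX_neq0 (N : nat) (S : idomainType) (j : 'I_N) : 'X_j != 0 :> {mpoly S[N]}.
Proof. by rewrite -msize_poly_eq0 msizeX. Qed.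

Lemma proportional_trans (S : idomainType) (P y : nat -> S) :
  y 0%N != 0 -> (forall n, (n <= i)%N -> P 0%N * y n = y 0%N * P n) ->
  forall a b, (a <= i)%N -> (b <= i)%N -> P a * y b = P b * y a.
Proof.
move=> y0 e a b le_a le_b; apply: (mulfI y0); rewrite mulrA -e //.
by rewrite mulrA -e // mulrAC.
Qed.

Variables (F G : i.+1.-tuple R) (d e : nat) (u v : k).
Hypothesis c0 : forall n, (0 < n <= i)%N -> (c 0%N n)%:~R != 0 :> R.
Hypothesis c1 : forall n, (0 < n <= i)%N -> (c n 0%N)%:~R != 0 :> R.
Hypotheses (u0 : u != 0) (v0 : v != 0).
Hypothesis F0 : map_up F 0 = u *: var_down 0 ^+ d.
Hypothesis G0 : map_down G 0 = v *: var_up 0 ^+ e.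
Hypothesis LF : forall n, (0 < n <= i)%N -> lform c var_down (map_up F) n = 0.
Hypothesis LG : forall n, (0 < n <= i)%N -> lform c (map_down G) var_up n = 0.

Let scale_neq0 (w : k) (p : R) : w != 0 -> p != 0 -> w *: p != 0.
Proof. by move=> w0 p0; rewrite -mul_mpolyC mulf_neq0 // mpolyC_eq0. Qed.

(** Substituting F into the system for G shows that G o F solves, against F, the same system as the
    coordinates y. As F_0 is nonzero, the two solutions are proportional. The other composite is
    treated in the same way. *)
Lemma inverse_maps_lform : inverse_maps F G.
Proof.
have F0n : map_up F 0 != 0 by rewrite F0 scale_neq0 // expf_neq0 // mpolyX_neq0.
have G0n : map_down G 0 != 0 by rewrite G0 scale_neq0 // expf_neq0 // mpolyX_neq0.
pose P a := map_down G a \mPo F; pose Q b := map_up F b \mPo G.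
have LP n : (0 < n <= i)%N -> lform c P (map_up F) n = 0.
  move=> le_n; have := congr1 (comp_mpoly F) (LG le_n).
  rewrite lform_morph rmorph0 => E; rewrite -[RHS]E.
  by apply: eq_lform => // a _ /=; rewrite comp_var_up.
have LQ n : (0 < n <= i)%N -> lform c (map_down G) Q n = 0.
  move=> le_n; have := congr1 (comp_mpoly G) (LF le_n).
  rewrite lform_morph rmorph0 => E; rewrite -[RHS]E.
  by apply: eq_lform => // a _ /=; rewrite comp_var_down.
split; split.
- exists (inord i); rewrite tnth_mktuple -/(map_up G i) (_ : map_up G i = map_down G 0).
    rewrite G0 comp_mpolyZ rmorphXn /= comp_var_up.
    by rewrite scale_neq0 ?expf_neq0.
  by rewrite /map_down subn0.
- have prop n : (n <= i)%N -> P 0%N * var_down n = var_down 0 * P n.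
    apply: (lform_proportional (c := fun a b => c b a) F0n) => // m le_m.
      by rewrite -lformC LP.
    by rewrite -lformC LF.
  move=> a b; rewrite !tnth_mktuple -!map_down_ord -!var_down_ord.
  by apply: (@proportional_trans R P var_down (mpolyX_neq0 k _) prop); rewrite leq_subr.
- exists (inord 0); rewrite tnth_mktuple -/(map_up F 0).
  rewrite F0 comp_mpolyZ rmorphXn /= comp_var_down.
  by rewrite scale_neq0 ?expf_neq0.
have prop n : (n <= i)%N -> Q 0%N * var_up n = var_up 0 * Q n.
  by apply: (lform_proportional (c := c) G0n) => // m le_m; rewrite ?LQ ?LG.
move=> a b; rewrite !tnth_mktuple -!map_up_ord -!var_up_ord.
by apply: (@proportional_trans R Q var_up (mpolyX_neq0 k _) prop); rewrite -ltnS.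
Qed.

End InverseMaps.

(** * Regular sequences of bilinear forms *)

Section RegularSequence.
Variables (S : comNzRingType) (c : nat -> nat -> int) (y T : nat -> S) (i : nat).
(** Stands for the ideal (y_0, ..., y_(m-1), T_0, ..., T_(l-1)), given only by the properties used
    in the induction. *)
Variable J : nat -> nat -> S -> Prop.
Local Notation L := (lform c y T).

Hypothesis c_unit : forall a b, (0 < a + b <= i)%N -> exists u : S, u * (c a b)%:~R = 1.
Hypothesis Jideal : forall m l, is_ideal (J m l).
Hypothesis Jy_reg : forall m l g, (m <= i)%N -> J m l (y m * g) -> J m l g.
Hypothesis JT_reg : forall m l g, (l <= i)%N -> J m l (T l * g) -> J m l g.
Hypothesis JyS : forall m l x, (m <= i)%N ->
  J m.+1 l x <-> exists g, J m l (x - y m * g).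
Hypothesis JTS : forall m l x, (l <= i)%N ->
  J m l.+1 x <-> exists g, J m l (x - T l * g).

Let J0 m l : J m l 0. Proof. by case: (Jideal m l). Qed.
Let JD m l u v : J m l u -> J m l v -> J m l (u + v).
Proof. by case: (Jideal m l) => _ + _; apply. Qed.
Let JM m l u v : J m l v -> J m l (u * v).
Proof. by case: (Jideal m l) => _ _; apply. Qed.
Let JB m l u v : J m l u -> J m l v -> J m l (u - v).
Proof. by move=> Ju Jv; rewrite -mulN1r; apply: JD => //; apply: JM. Qed.

Let J_incly m l x : (m <= i)%N -> J m l x -> J m.+1 l x.
Proof. by move=> le_m Jx; apply/JyS => //; exists 0; rewrite mulr0 subr0. Qed.
Let J_inclT m l x : (l <= i)%N -> J m l x -> J m l.+1 x.
Proof. by move=> le_m Jx; apply/JTS => //; exists 0; rewrite mulr0 subr0. Qed.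

Let Jy m l a : (a < m <= i.+1)%N -> J m l (y a).
Proof.
elim: m => // m IH /andP[]; rewrite ltnS ltnS leq_eqVlt => /predU1P[->|lt_am] le_m.
  by apply/JyS => //; exists 1; rewrite mulr1 subrr.
by apply: J_incly => //; apply: IH; rewrite lt_am leqW.
Qed.

Let JT m l b : (b < l <= i.+1)%N -> J m l (T b).
Proof.
elim: l => // l IH /andP[]; rewrite ltnS ltnS leq_eqVlt => /predU1P[->|lt_bl] le_l.
  by apply/JTS => //; exists 1; rewrite mulr1 subrr.
by apply: J_inclT => //; apply: IH; rewrite lt_bl leqW.
Qed.

(** Every other term y_a T_b of this form has a < m or b < l. *)
Let JL m l : (m + l <= i)%N -> J m l (L (m + l) - (c m l)%:~R * (y m * T l)).
Proof.
move=> le_ml; have lt_m : (m < (m + l).+1)%N by lia.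
rewrite /lform (bigD1 (Ordinal lt_m)) //= addKn addrAC subrr add0r.
elim/big_ind: _ => [||a ne_am]; [exact: J0 | exact: JD |].
apply: JM; have [lt_am|lt_ma|eq_am] := ltngtP a m.
- by rewrite mulrC; apply/JM/Jy; lia.
- by apply/JM/JT; have := ltn_ord a; lia.
- by case/eqP: ne_am; apply: val_inj.
Qed.

(** The sum starts at m + l because the forms of smaller index already lie in [J m l]. *)
Definition JL_ideal m l n x :=
  exists a : nat -> S, J m l (x - \sum_(m + l <= s < n) a s * L s).
Local Notation K := JL_ideal.

Lemma JL_idealP m l n : is_ideal (K m l n).
Proof.
split=> [|u v [a Ja] [b Jb]|u v [a Ja]].
- by exists (fun=> 0); rewrite big1 ?subr0 // => s _; rewrite mul0r.
- exists (fun s => a s + b s).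
  have -> : \sum_(m + l <= s < n) (a s + b s) * L s =
    \sum_(m + l <= s < n) a s * L s + \sum_(m + l <= s < n) b s * L s.
    by rewrite -big_split; apply: eq_bigr => s _; rewrite mulrDl.
  by rewrite opprD addrACA; apply: JD.
exists (fun s => u * a s).
have -> : \sum_(m + l <= s < n) u * a s * L s = u * \sum_(m + l <= s < n) a s * L s.
  by rewrite mulr_sumr; apply: eq_bigr => s _; rewrite mulrA.
by rewrite -mulrBr; apply: JM.
Qed.

Let KD m l n u v : K m l n u -> K m l n v -> K m l n (u + v).
Proof. by case: (JL_idealP m l n) => _ + _; apply. Qed.
Let KM m l n u v : K m l n v -> K m l n (u * v).
Proof. by case: (JL_idealP m l n) => _ _; apply. Qed.
Let KN m l n u : K m l n u -> K m l n (- u).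
Proof. by move=> Ku; rewrite -mulN1r; apply: KM. Qed.

Let KJ m l n x : J m l x -> K m l n x.
Proof.
by move=> Jx; exists (fun=> 0); rewrite big1 ?subr0 // => s _; rewrite mul0r.
Qed.

Let K_recr m l n x : (m + l <= n)%N -> K m l n.+1 x <-> exists h, K m l n (x - h * L n).
Proof.
move=> le_n; split=> [[a Ja]|[h [a Ja]]].
  by exists (a n); exists a; move: Ja; rewrite big_nat_recr //= opprD addrAC addrA.
exists (fun s => if s == n then h else a s).
rewrite big_nat_recr //= eqxx; move: Ja; congr (J m l _).
rewrite opprD addrA addrAC; congr (_ - _ - _); apply: eq_big_nat => s /andP[_ lt_s].
by rewrite ltn_eqF.
Qed.

Let K_recl m l n x : (m + l < n)%N -> K m l n x ->
  exists h a, J m l (x - h * L (m + l) - \sum_((m + l).+1 <= s < n) a s * L s).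
Proof.
by move=> lt_n [a]; rewrite big_ltn // opprD addrA => Ja; exists (a (m + l)%N), a.
Qed.

(** The generator [L (m + l)] leaves the list but is not lost: modulo [J m l] it is a multiple of
    y_m. *)
Let K_incly m l n x : (m + l <= n)%N -> (n <= i)%N -> K m l n x -> K m.+1 l n x.
Proof.
move=> le_mln le_n; move: le_mln; rewrite leq_eqVlt => /predU1P[eq_n|lt_n] Kx.
  case: Kx => a; rewrite -eq_n big_geq // subr0 => Jx.
  by apply: KJ; apply: J_incly => //; lia.
have [h [a Ja]] := K_recl lt_n Kx.
exists a; rewrite addSn; rewrite -(subrK (h * L (m + l)) x) addrAC.
apply: JD; first by apply: J_incly => //; lia.
apply: JM; rewrite -[L _](subrK ((c m l)%:~R * (y m * T l))); apply: JD.
  by apply: J_incly; [lia | apply: JL; lia].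
by apply: JM; rewrite mulrC; apply: JM; apply: Jy; lia.
Qed.

Let K_split m l n x : (m + l <= n)%N -> (n <= i)%N -> K m.+1 l n x ->
  exists g, K m l n (x - y m * g).
Proof.
move=> le_mln le_n [a Ja]; case/JyS: Ja => [|g Jg]; first by lia.
exists g; move: le_mln; rewrite leq_eqVlt => /predU1P[eq_n|lt_n].
  by apply: KJ; move: Jg; rewrite big_geq ?subr0 // -eq_n.
exists (fun s => if s == (m + l)%N then 0 else a s).
rewrite big_ltn // eqxx mul0r add0r addrAC; move: Jg; congr (J m l (_ - _ - _)).
by rewrite addSn; apply: eq_big_nat => s /andP[lt_s _]; rewrite gtn_eqF.
Qed.

Definition regular_at m l n := forall g, K m l n (g * L n) -> K m l n g.

(** One half of the colon computation (K m l n : y_m) = K m l.+1 n. With a single form, y_m is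
    cancelled modulo [J m l]. Otherwise y_m g = h L_n modulo the earlier forms, so h L_n vanishes
    modulo y_m; regularity there gives h = y_m h', and the induction applies to g - h' L_n. *)
Let K_div_y m l n g : (0 < m + l < n)%N -> (n <= i)%N ->
  (forall n', (m + l < n' < n)%N -> regular_at m.+1 l n') ->
  K m l n (y m * g) -> K m l.+1 n g.
Proof.
move=> /andP[ml0]; elim: n g => // n IH g; rewrite ltnS leq_eqVlt.
case/predU1P=> [eq_n|lt_n] le_n reg.
  case=> a; rewrite -eq_n big_nat1 => Ja; apply: KJ; apply/JTS; first by lia.
  exists (a (m + l)%N * (c m l)%:~R); apply: (@Jy_reg m); first by lia.
  have := JD Ja (JM (a (m + l)%N) (@JL m l _)); move=> /(_ ltac:(lia)).
  by congr (J m l _); ring.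
move=> Kg; case/(K_recr _ (ltnW lt_n)): Kg => h Kh.
have KhL : K m.+1 l n (h * L n).
  have -> : h * L n = g * y m - (y m * g - h * L n) by ring.
  apply: KD; first by apply: KJ; apply: JM; apply: Jy; lia.
  by apply: KN; apply: K_incly => //; lia.
have [h' Kh'] := K_split (ltnW lt_n) (ltnW le_n) (reg n ltac:(lia) h KhL).
apply/K_recr; first by lia.
exists h'; apply: IH => // [|n' lt_n'|]; [lia | by apply: reg; lia|].
have -> : y m * (g - h' * L n) = y m * g - h * L n + L n * (h - y m * h') by ring.
by apply: KD => //; apply: KM.
Qed.

(** The other half: y_m T_l is a unit times [L (m + l)] modulo [J m l]. *)
Let K_mul_y m l n g : (0 < m + l <= n)%N -> (n <= i)%N -> K m l.+1 n g ->
  (m + l < n)%N -> K m l n (y m * g).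
Proof.
move=> /andP[ml0 le_mln] le_n [a Ja] lt_n.
move: Ja; rewrite addnS => /JTS-[|h Jh]; first by lia.
have -> : y m * g = y m * (g - \sum_((m + l).+1 <= s < n) a s * L s - T l * h)
    + y m * (\sum_((m + l).+1 <= s < n) a s * L s) + h * (y m * T l) by ring.
apply: KD; first apply: KD.
- by apply/KM/KJ.
- apply: KM; exists (fun s => if s == (m + l)%N then 0 else a s).
  rewrite [X in _ - X]big_ltn // eqxx mul0r add0r.
  rewrite [X in _ - X](eq_big_nat _ _ (F2 := fun s => a s * L s)) ?subrr.
    exact: J0.
  by move=> s /andP[lt_s _]; rewrite gtn_eqF.
apply: KM; have [u uc] := c_unit (a := m) (b := l) ltac:(lia).
rewrite -[y m * T l]mul1r -uc -mulrA; apply: KM.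
rewrite -[X in K _ _ _ X](subrK (L (m + l))); apply: KD.
  by rewrite -opprB; apply/KN/KJ/JL; lia.
exists (fun s => if s == (m + l)%N then 1 else 0).
rewrite big_ltn // eqxx mul1r big_nat big1 ?addr0 ?subrr // => s /andP[lt_s _].
by rewrite gtn_eqF ?mul0r.
Qed.

(* Modulo [J m l], the form [L (m + l)] is a unit times [y m * T l], and
     0 -> S / J m l.+1 -> S / (J m l + y m * T l) -> S / J m.+1 l -> 0
   is exact; the remaining forms are regular on both ends, hence in the middle. *)
Theorem lform_regular m l n : (0 < m + l <= n)%N -> (n <= i)%N -> regular_at m l n.
Proof.
move=> /andP[ml0 le_mln]; have [d] := ubnP (n - (m + l)).
elim: d => // d IH in m l n ml0 le_mln * => lt_d le_n g Kg.
(* For n = m + l no form precedes L_n, which is a unit times y_m T_l modulo [J m l]; both factors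
   are regular there. *)
move: (le_mln); rewrite leq_eqVlt => /predU1P[eq_n|lt_n].
  move: Kg; rewrite -eq_n => -[a]; rewrite big_geq // subr0 => Jg.
  apply: KJ; apply: (@JT_reg m l); first by lia.
  apply: (@Jy_reg m l); first by lia.
  have [u uc] := c_unit (a := m) (b := l) ltac:(lia).
  rewrite -[y m * _]mul1r -uc -mulrA; apply: JM.
  have := JB Jg (JM g (@JL m l _)); move=> /(_ ltac:(lia)).
  by congr (J m l _); ring.
have Kg1 : K m.+1 l n g.
  by apply: IH; [lia | lia | lia | by [] | apply: K_incly].
have [g' Kg'] := K_split le_mln le_n Kg1.
(* Regularity modulo y_m has left g = y_m g'. The colon computation carries y_m g' L_n to g' L_n
   modulo T_l, where the induction applies to g'. *)
rewrite -(subrK (y m * g') g); apply: KD => //; apply: K_mul_y => //; first by lia.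
apply: (IH); [lia | lia | lia | by [] |].
apply: K_div_y => //; first by lia.
  by move=> n' lt_n' h; apply: IH; lia.
have -> : y m * (g' * L n) = g * L n - L n * (g - y m * g') by ring.
by apply: KD => //; apply/KN/KM.
Qed.

(** Moves y_0 from the front of the regular sequence to its end. In a relation for y_0 g, the
    coefficient of the last form is killed by that form modulo y_0 and the earlier ones, hence is
    y_0 h modulo the earlier forms; subtracting h times the last form from g lowers n. *)
Lemma lform_ideal_reg_y0 n g : (forall x, J 0 0 x -> x = 0) -> (n <= i)%N ->
  (exists a : nat -> S, y 0%N * g = \sum_(1 <= s < n.+1) a s * L s) ->
  exists a : nat -> S, g = \sum_(1 <= s < n.+1) a s * L s.
Proof.
move=> J00; elim: n g => [|n IH] g le_n [a].
  rewrite big_geq // => e; exists a; rewrite big_geq //; apply: J00.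
  by apply: (@Jy_reg 0) => //; rewrite e.
rewrite big_nat_recr //= => e.
have KaL : K 1 0 n.+1 (a n.+1 * L n.+1).
  exists (fun s => - a s); apply/JyS => //; exists g; rewrite e.
  rewrite addn0 (_ : \sum_(1 <= s < n.+1) - a s * L s = - \sum_(1 <= s < n.+1) a s * L s).
    by set z := (X in J _ _ X); have -> : z = 0 by rewrite /z; ring.
  by rewrite -sumrN; apply: eq_bigr => s _; rewrite mulNr.
have [b] := lform_regular (m := 1) (l := 0) (n := n.+1) ltac:(lia) le_n KaL.
case/JyS=> // h /J00/eqP; rewrite subr_eq0 subr_eq => /eqP eb.
have [|b' eb'] := IH (g - h * L n.+1) (ltnW le_n).
  exists (fun s => a s + b s * L n.+1).
  rewrite mulrBr e eb; under [RHS]eq_bigr do rewrite mulrDl mulrAC.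
  by rewrite big_split -mulr_suml /=; ring.
exists (fun s => if s == n.+1 then h else b' s).
rewrite big_nat_recr //= eqxx -[LHS](subrK (h * L n.+1)) eb'; congr (_ + _).
by apply: eq_big_nat => s /andP[_ lt_s]; rewrite ltn_eqF.
Qed.

End RegularSequence.

(** * Elimination of variables *)

Lemma is_ideal_sum (A : comNzRingType) (I : A -> Prop) (T : Type) (r : seq T)
    (P : pred T) (F : T -> A) :
  is_ideal I -> (forall t, P t -> I (F t)) -> I (\sum_(t <- r | P t) F t).
Proof. by move=> [I0 ID _] IF; elim/big_ind: _. Qed.

Lemma ideal_genP (A : comNzRingType) m (g : 'I_m -> A) : is_ideal (ideal_gen g).
Proof.
split=> [|x y [a ->] [b ->]|u x [a ->]].
- by exists (fun=> 0); rewrite big1 // => j _; rewrite mul0r.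
- by exists (fun j => a j + b j); rewrite -big_split; apply: eq_bigr => j _; rewrite mulrDl.
by exists (fun j => u * a j); rewrite mulr_sumr; apply: eq_bigr => j _; rewrite mulrA.
Qed.

Lemma ideal_gen_gen (A : comNzRingType) m (g : 'I_m -> A) j : ideal_gen g (g j).
Proof.
exists (fun l => (l == j)%:R); rewrite (bigD1 j) //= eqxx mul1r big1 ?addr0 // => l.
by move=> /negPf->; rewrite mul0r.
Qed.

Lemma ideal_gen_sub (A : comNzRingType) m (g : 'I_m -> A) (I : A -> Prop) :
  is_ideal I -> (forall j, I (g j)) -> subideal (ideal_gen g) I.
Proof.
move=> II Ig x [a ->]; apply: is_ideal_sum => // j _.
by case: II => _ _ IM; apply: IM.
Qed.

Lemma mul_ideal (A : comNzRingType) (z : A) : is_ideal (fun x => exists h, x = z * h).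
Proof.
split=> [|_ _ [u ->] [v ->]|u _ [v ->]]; first by exists 0; rewrite mulr0.
  by exists (u + v); rewrite mulrDr.
by exists (u * v); rewrite mulrCA.
Qed.

Lemma zero_ideal (A : comNzRingType) : is_ideal (fun x : A => x = 0).
Proof. by split=> [//|_ _ -> ->|u _ ->]; rewrite ?addr0 ?mulr0. Qed.

Lemma ker_ideal (A B : comNzRingType) (f : {rmorphism A -> B}) : is_ideal (fun x => f x = 0).
Proof.
split=> [|x y fx fy|u x fx]; first exact: rmorph0.
  by rewrite rmorphD fx fy addr0.
by rewrite rmorphM fx mulr0.
Qed.

Lemma mpoly_rmorph_mod (n : nat) (A B : comNzRingType) (I : B -> Prop)
    (f g : {rmorphism {mpoly A[n]} -> B}) :
  is_ideal I -> (forall a, I (f a%:MP - g a%:MP)) -> (forall j, I (f 'X_j - g 'X_j)) ->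
  forall p, I (f p - g p).
Proof.
move=> II fC fX; case: (II) => I0 ID IM.
have fM p q : I (f p - g p) -> I (f q - g q) -> I (f (p * q) - g (p * q)).
  move=> fp fq; have -> : f (p * q) - g (p * q) = f p * (f q - g q) + g q * (f p - g p).
    by rewrite !rmorphM; ring.
  by apply: ID; apply: IM.
have f1 : I (f 1 - g 1) by rewrite !rmorph1 subrr.
elim/mpolyind => [|a m p _ _ fp]; first by rewrite !rmorph0 subr0.
rewrite !rmorphD opprD addrACA; apply: ID => //; rewrite -mul_mpolyC.
apply: (fM) => //; rewrite mpolyXE_id.
pose Q x := I (f x - g x); rewrite -/(Q _).
elim/big_ind: _ => [//|x z|j _]; first exact: fM.
by elim: (m j) => // d IH; rewrite exprS; apply: fM.
Qed.

Lemma mpoly_rmorph_eq (n : nat) (A B : comNzRingType)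
    (f g : {rmorphism {mpoly A[n]} -> B}) :
  (forall a, f a%:MP = g a%:MP) -> (forall j, f 'X_j = g 'X_j) -> f =1 g.
Proof.
move=> fC fX p; apply/eqP; rewrite -subr_eq0; apply/eqP.
by apply: (mpoly_rmorph_mod (zero_ideal B)) => [a|j]; rewrite ?fC ?fX subrr.
Qed.

Section VariableElimination.
Variables (k : fieldType) (i : nat) (s : nat -> 'I_i.+1) (rk : 'I_i.+1 -> nat).
Hypothesis sK : forall a, (a <= i)%N -> rk (s a) = a.
Hypothesis rkK : forall v, s (rk v) = v.
Local Notation R := {mpoly k[i.+1]}.
Local Notation S := {mpoly R[i.+1]}.

(** Reduction modulo (y_0, ..., y_(m-1)), realised inside R so that membership becomes an equation.
    The numbering [s], with inverse [rk], is a parameter because the maps number the variables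
    downwards and their inverses upwards. *)
Definition kill (m : nat) : R -> R :=
  comp_mpoly [tuple if (rk v < m)%N then 0 else 'X_v | v < i.+1].
HB.instance Definition _ m := GRing.RMorphism.on (kill m).

Lemma killC m a : kill m a%:MP = a%:MP. Proof. exact: comp_mpolyC. Qed.

Lemma killX m v : kill m 'X_v = if (rk v < m)%N then 0 else 'X_v.
Proof. by rewrite /kill comp_mpolyXU -tnth_nth tnth_mktuple. Qed.

Lemma kill_comp m m' p : (m <= m')%N -> kill m' (kill m p) = kill m' p.
Proof.
move=> le_m; move: p.
apply: (mpoly_rmorph_eq (f := kill m' \o kill m) (g := kill m')) => [a|v] /=.
  by rewrite !killC.
rewrite !killX; have [lt_v|le_v] := ltnP (rk v) m; last by rewrite killX.
by rewrite rmorph0 (leq_trans lt_v le_m).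
Qed.

Lemma kill_mod m p : (m <= i)%N -> exists h, kill m p - kill m.+1 p = 'X_(s m) * h.
Proof.
move=> le_m; apply: (mpoly_rmorph_mod (mul_ideal _)) => [a|v] /=.
  by exists 0; rewrite !killC subrr mulr0.
rewrite !killX ltnS; case: ltngtP => [_|_|<-].
- by exists 0; rewrite subrr mulr0.
- by exists 0; rewrite subrr mulr0.
by exists 1; rewrite rkK subr0 mulr1.
Qed.

(** Its kernel plays the role of [J m l]. The image lies in the domain S, which makes y_m and T_l
    regular modulo this kernel. *)
Definition kill2 (m l : nat) : S -> S :=
  mmap (@mpolyC i.+1 R \o kill m) (fun b => if (b < l)%N then 0 else 'X_b).
HB.instance Definition _ m l := GRing.RMorphism.on (kill2 m l).

Lemma kill2C m l a : kill2 m l a%:MP = (kill m a)%:MP.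
Proof. by rewrite /kill2 mmapC. Qed.

Lemma kill2X m l b : kill2 m l 'X_b = if (b < l)%N then 0 else 'X_b.
Proof. by rewrite /kill2 mmapX mmap1U. Qed.

Lemma kill2_comp m m' l l' p : (m <= m')%N -> (l <= l')%N ->
  kill2 m' l' (kill2 m l p) = kill2 m' l' p.
Proof.
move=> le_m le_l; move: p.
apply: (mpoly_rmorph_eq (f := kill2 m' l' \o kill2 m l) (g := kill2 m' l')) => [a|b] /=.
  by rewrite !kill2C kill_comp.
rewrite !kill2X; have [lt_b|le_b] := ltnP b l; last by rewrite kill2X.
by rewrite rmorph0 (leq_trans lt_b le_l).
Qed.

Definition yvar (a : nat) : S := ('X_(s a))%:MP.
Definition Tvar (b : nat) : S := 'X_(inord b).

Lemma kill2_yvar m l a : (a <= i)%N -> kill2 m l (yvar a) = if (a < m)%N then 0 else yvar a.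
Proof.
by move=> le_a; rewrite kill2C killX sK //; case: ifP => // _; rewrite mpolyC0.
Qed.

Lemma kill2_Tvar m l b : (b <= i)%N -> kill2 m l (Tvar b) = if (b < l)%N then 0 else Tvar b.
Proof. by move=> le_b; rewrite kill2X inordK. Qed.

Lemma kill2_mod_y m l p : (m <= i)%N -> exists h, kill2 m l p - kill2 m.+1 l p = yvar m * h.
Proof.
move=> le_m; apply: (mpoly_rmorph_mod (mul_ideal _)) => [a|b] /=.
  have [h eh] := kill_mod a le_m.
  by exists h%:MP; rewrite !kill2C -mpolyCB eh mpolyCM.
by exists 0; rewrite !kill2X subrr mulr0.
Qed.

Lemma kill2_mod_T m l p : (l <= i)%N -> exists h, kill2 m l p - kill2 m l.+1 p = Tvar l * h.
Proof.
move=> le_l; apply: (mpoly_rmorph_mod (mul_ideal _)) => [a|b] /=.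
  by exists 0; rewrite !kill2C subrr mulr0.
rewrite !kill2X ltnS; case: ltngtP => [_|_|eq_b].
- by exists 0; rewrite subrr mulr0.
- by exists 0; rewrite subrr mulr0.
by exists 1; rewrite subr0 mulr1 /Tvar -eq_b inord_val.
Qed.

Lemma yvar_neq0 a : yvar a != 0.
Proof. by rewrite /yvar mpolyC_eq0 (mpolyX_neq0 k). Qed.

Lemma Tvar_neq0 b : Tvar b != 0. Proof. exact: (mpolyX_neq0 R). Qed.

Let J m l (x : S) := kill2 m l x = 0.

Lemma kill2_y_reg m l g : (m <= i)%N -> J m l (yvar m * g) -> J m l g.
Proof.
move=> le_m; rewrite /J rmorphM /= kill2_yvar // ltnn => /eqP.
by rewrite mulf_eq0 (negPf (yvar_neq0 m)) => /eqP.
Qed.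

Lemma kill2_T_reg m l g : (l <= i)%N -> J m l (Tvar l * g) -> J m l g.
Proof.
move=> le_m; rewrite /J rmorphM /= kill2_Tvar // ltnn => /eqP.
by rewrite mulf_eq0 (negPf (Tvar_neq0 l)) => /eqP.
Qed.

Lemma kill2_yS m l x : (m <= i)%N -> J m.+1 l x <-> exists g, J m l (x - yvar m * g).
Proof.
rewrite /J => le_m; split=> [Jx|[g Jg]].
  have [g eg] := kill2_mod_y l x le_m; exists g; move: eg; rewrite Jx subr0 => eg.
  by rewrite rmorphB /= -eg kill2_comp // subrr.
rewrite -(subrK (yvar m * g) x) rmorphD /= -(@kill2_comp m _ l _ (_ - _)) // Jg rmorph0.
by rewrite rmorphM /= kill2_yvar // ltnSn mul0r addr0.
Qed.

Lemma kill2_TS m l x : (l <= i)%N -> J m l.+1 x <-> exists g, J m l (x - Tvar l * g).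
Proof.
rewrite /J => le_l; split=> [Jx|[g Jg]].
  have [g eg] := kill2_mod_T m x le_l; exists g; move: eg; rewrite Jx subr0 => eg.
  by rewrite rmorphB /= -eg kill2_comp // subrr.
rewrite -(subrK (Tvar l * g) x) rmorphD /= -(@kill2_comp m _ l _ (_ - _)) // Jg rmorph0.
by rewrite rmorphM /= kill2_Tvar // ltnSn mul0r addr0.
Qed.

Lemma kill2_00 x : kill2 0 0 x = x.
Proof.
apply: (mpoly_rmorph_eq (f := kill2 0 0) (g := idfun)) => [a|b] /=.
  rewrite kill2C; congr _%:MP; move: a.
  by apply: (mpoly_rmorph_eq (f := kill 0) (g := idfun)) => [a|v] /=; rewrite ?killC ?killX.
by rewrite kill2X.
Qed.

Variable c : nat -> nat -> int.
Hypothesis c_neq0 : forall a b, (0 < a + b)%N -> (c a b)%:~R != 0 :> k.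

Lemma mpoly2_int_inv (z : int) : z%:~R != 0 :> k -> exists u : S, u * z%:~R = 1.
Proof.
move=> z0; exists ((z%:~R^-1)%:MP)%:MP.
rewrite -(rmorph_int (@mpolyC i.+1 R)) -(rmorph_int (@mpolyC i.+1 k)).
by rewrite -!rmorphM mulVf // !rmorph1.
Qed.

Definition Lgen (j : 'I_i) : S := lform c yvar Tvar j.+1.

Let Lgen_sum x : (exists a : nat -> S, x = \sum_(1 <= t < i.+1) a t * lform c yvar Tvar t)
  <-> ideal_gen Lgen x.
Proof.
split=> [[a ->]|[a ->]].
  by exists (fun j => a j.+1); rewrite big_add1 big_mkord.
case: (posnP i) => [i0|i_gt0].
  exists (fun=> 0); rewrite big_geq ?i0 // big1 // => j _.
  by have := ltn_ord j; rewrite {2}i0.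
exists (fun t => if insub t.-1 is Some j then a j else 0).
rewrite big_add1 big_mkord /=; apply: eq_bigr => j _.
by rewrite valK.
Qed.

Theorem yvar_regular N g : ideal_gen Lgen (yvar 0 ^+ N * g) -> ideal_gen Lgen g.
Proof.
elim: N g => [|N IH] g; first by rewrite mul1r.
rewrite exprSr -mulrA => /IH; rewrite -!Lgen_sum.
have cu a b : (0 < a + b <= i)%N -> exists u : S, u * (c a b)%:~R = 1.
  by case/andP=> ab0 _; apply/mpoly2_int_inv/c_neq0.
have J00 x : J 0 0 x -> x = 0 by rewrite /J kill2_00.
have Jid m l : is_ideal (J m l) by apply: ker_ideal.
exact: (lform_ideal_reg_y0 cu Jid kill2_y_reg kill2_T_reg kill2_yS kill2_TS J00 (leqnn i)).
Qed.

End VariableElimination.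

(** * Modules attached to an ideal *)

Section IdealModule.
Variables (A : comNzRingType) (n : nat) (g : 'I_n -> A).

(** Made boolean by classical logic, as the submodule and quotient structures require. *)
Definition ideal_mem (x : A^o) : bool := `[< ideal_gen g x >].

Lemma ideal_memP x : reflect (ideal_gen g x) (ideal_mem x).
Proof. exact: asboolP. Qed.

Lemma ideal_mem_closed : submod_closed ideal_mem.
Proof.
have [I0 ID IM] := ideal_genP g.
split=> [|a x y /ideal_memP Ix /ideal_memP Iy]; first exact/ideal_memP.
by apply/ideal_memP; apply: ID => //; apply: IM.
Qed.
HB.instance Definition _ := GRing.isSubmodClosed.Build A A^o ideal_mem ideal_mem_closed.

Definition ideal_module := {x : A^o | ideal_mem x}.
HB.instance Definition _ := SubType.on ideal_module.
HB.instance Definition _ := Choice.on ideal_module.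
HB.instance Definition _ := [SubChoice_isSubLmodule of ideal_module by <:].

Definition ideal_incl : {linear ideal_module -> A^o} := \val.

Lemma ideal_module_gen_mem j : ideal_mem (g j).
Proof. exact/ideal_memP/ideal_gen_gen. Qed.

Definition ideal_module_gen j : ideal_module := exist _ (g j) (ideal_module_gen_mem j).

Lemma ideal_moduleE (e : ideal_module) : exists a : 'I_n -> A,
  e = \sum_j a j *: ideal_module_gen j.
Proof.
have /ideal_memP[a ea] := valP e; exists a; apply: val_inj.
rewrite -[RHS]/(ideal_incl _) linear_sum [LHS]ea.
by apply: eq_bigr => j _; rewrite linearZ.
Qed.

Definition ideal_zmod : zmodClosed A^o := GRing.ZmodClosed.clone A^o ideal_mem _.
Definition ideal_quotient := Quotient.quot ideal_zmod.
HB.instance Definition _ := GRing.Zmodule.on ideal_quotient.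
Local Notation Q := ideal_quotient.
Local Notation piQ := (\pi_(Quotient.quot ideal_zmod)%qT : A^o -> Q).

Lemma piQ_eq (x y : A^o) : (piQ x = piQ y) <-> ideal_gen g (x - y).
Proof.
split=> [/eqP e|e]; first by apply/ideal_memP; move: e; rewrite -Quotient.idealrBE.
by apply/eqP; rewrite -Quotient.idealrBE; apply/ideal_memP.
Qed.

Lemma piQB : zmod_morphism piQ. Proof. exact: raddfB. Qed.

Lemma piQ_repr (x : Q) : piQ (repr x) = x. Proof. exact: reprK. Qed.

Definition quot_scale (a : A) (x : Q) : Q := piQ (a *: (repr x : A^o)).

Lemma quot_scale_pi a x : quot_scale a (piQ x) = piQ (a *: x).
Proof.
apply/piQ_eq; rewrite -scalerBr; case: (ideal_genP g) => _ _; apply.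
by apply/piQ_eq; rewrite piQ_repr.
Qed.

Lemma quot_scaleA a b x : quot_scale a (quot_scale b x) = quot_scale (a * b) x.
Proof. by rewrite -(piQ_repr x) !quot_scale_pi scalerA. Qed.

Lemma quot_scale1 : left_id 1 quot_scale.
Proof. by move=> x; rewrite -(piQ_repr x) quot_scale_pi scale1r. Qed.

Lemma piQD x y : piQ (x + y) = piQ x + piQ y. Proof. exact: raddfD. Qed.

Lemma quot_scaleDr : right_distributive quot_scale +%R.
Proof.
move=> a x y; rewrite -(piQ_repr x) -(piQ_repr y) -piQD !quot_scale_pi.
by rewrite scalerDr piQD.
Qed.

Lemma quot_scaleDl x : {morph quot_scale^~ x : a b / a + b}.
Proof.
by move=> a b /=; rewrite -(piQ_repr x) !quot_scale_pi scalerDl piQD.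
Qed.

HB.instance Definition _ := GRing.Zmodule_isLmodule.Build A Q
  quot_scaleA quot_scale1 quot_scaleDr quot_scaleDl.

Definition ideal_proj (x : A^o) : Q := piQ x.
HB.instance Definition _ := GRing.isZmodMorphism.Build A^o Q ideal_proj piQB.
Lemma ideal_proj_scalable : scalable ideal_proj.
Proof. by move=> a x; rewrite /ideal_proj -quot_scale_pi. Qed.
HB.instance Definition _ := GRing.isScalable.Build A A^o Q _ ideal_proj ideal_proj_scalable.

Lemma ideal_proj_eq0 x : ideal_proj x = 0 <-> ideal_gen g x.
Proof. by rewrite -(raddf0 ideal_proj) /ideal_proj piQ_eq subr0. Qed.

Lemma ideal_proj_quotient : is_quotient (ideal_gen g) ideal_proj.
Proof.
split=> [y|x]; first by exists (repr y); apply: piQ_repr.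
exact: ideal_proj_eq0.
Qed.

Definition rees_map : {mpoly A[n]} -> {poly A} :=
  mmap (@polyC A) (fun j : 'I_n => g j *: 'X).
HB.instance Definition _ := GRing.RMorphism.on rees_map.

Lemma rees_mapC a : rees_map a%:MP = a%:P.
Proof. by rewrite /rees_map mmapC. Qed.

Lemma rees_mapX j : rees_map 'X_j = g j *: 'X.
Proof. by rewrite /rees_map mmapX mmap1U. Qed.

Definition rees_mem (p : {poly A}) : bool := `[< exists H, rees_map H = p >].

Lemma rees_memP p : reflect (exists H, rees_map H = p) (rees_mem p).
Proof. exact: asboolP. Qed.

Lemma rees_mem_closed : subalg_closed rees_mem.
Proof.
split=> [|a _ _ /rees_memP[H <-] /rees_memP[K <-]|_ _ /rees_memP[H <-] /rees_memP[K <-]].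
- by apply/rees_memP; exists 1; rewrite rmorph1.
- apply/rees_memP; exists (a%:MP * H + K).
  by rewrite rmorphD rmorphM /= (rees_mapC a) mul_polyC.
by apply/rees_memP; exists (H * K); rewrite rmorphM.
Qed.
HB.instance Definition _ := GRing.isSubalgClosed.Build A {poly A} rees_mem rees_mem_closed.

Definition rees := {p : {poly A} | rees_mem p}.
HB.instance Definition _ := SubType.on rees.
HB.instance Definition _ := Choice.on rees.
HB.instance Definition _ := [SubChoice_isSubLalgebra of rees by <:].
HB.instance Definition _ := [SubNzRing_isSubComNzRing of rees by <:].
HB.instance Definition _ := GRing.Lalgebra_isComAlgebra.Build A rees.

End IdealModule.

(** * Equations of the Rees algebra *)

Section ReesRelations.
Variables (k : fieldType) (i : nat) (s : nat -> 'I_i.+1) (rk : 'I_i.+1 -> nat).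
Hypothesis sK : forall a, (a <= i)%N -> rk (s a) = a.
Hypothesis rkK : forall v, s (rk v) = v.
Variable c : nat -> nat -> int.
Hypothesis c_neq0 : forall a b, (0 < a + b)%N -> (c a b)%:~R != 0 :> k.
Local Notation R := {mpoly k[i.+1]}.
Local Notation S := {mpoly R[i.+1]}.

Definition yR (a : nat) : R := 'X_(s a).
Definition Fsol (b : nat) : R := asol c yR i b.
Local Notation Lg := (Lgen k s c).

Lemma Fsol0 : Fsol 0 = yR 0 ^+ i. Proof. exact: asol0. Qed.

Lemma Fsol0_neq0 : Fsol 0 != 0.
Proof. by rewrite Fsol0 expf_neq0 // (mpolyX_neq0 k). Qed.

Lemma lform_Fsol n : (0 < n <= i)%N -> lform c yR Fsol n = 0.
Proof. by apply: lform_asol => m m0; apply: c_neq0. Qed.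

Definition rees_eval : S -> {poly R} := rees_map (fun b : 'I_i.+1 => Fsol b).
HB.instance Definition _ := GRing.RMorphism.on rees_eval.

Lemma rees_eval0 : rees_eval 0 = 0. Proof. exact: rmorph0. Qed.

Lemma rees_evalD x z : rees_eval (x + z) = rees_eval x + rees_eval z.
Proof. exact: rmorphD. Qed.

Lemma rees_evalM x z : rees_eval (x * z) = rees_eval x * rees_eval z.
Proof. exact: rmorphM. Qed.

Lemma rees_evalC a : rees_eval a%:MP = a%:P. Proof. exact: rees_mapC. Qed.

Lemma rees_evalX b : rees_eval 'X_b = Fsol b *: 'X. Proof. exact: rees_mapX. Qed.

Lemma rees_eval_Tvar b : (b <= i)%N -> rees_eval (Tvar k i b) = Fsol b *: 'X.
Proof. by move=> le_b; rewrite rees_evalX inordK. Qed.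

Lemma rees_eval_Lgen j : rees_eval (Lg j) = 0.
Proof.
rewrite /Lgen lform_morph.
have -> : lform c (rees_eval \o yvar k s) (rees_eval \o Tvar k i) j.+1
    = lform c yR Fsol j.+1 *: 'X.
  rewrite /lform scaler_suml; apply: eq_bigr => a _ /=.
  rewrite (rees_evalC (yR _)) rees_eval_Tvar; last by have := ltn_ord j; lia.
  rewrite -!mul_polyC !polyCM -(rmorph_int (@polyC R)); ring.
by rewrite lform_Fsol ?scale0r // ltn_ord.
Qed.

Lemma rees_eval_ideal x : ideal_gen Lg x -> rees_eval x = 0.
Proof. exact: (ideal_gen_sub (ker_ideal rees_eval) rees_eval_Lgen). Qed.

Definition theta (p : {poly R}) : S := (map_poly (@mpolyC i.+1 R) p).[Tvar k i 0].

Let theta0 : theta 0 = 0.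
Proof. by rewrite /theta rmorph0 horner0. Qed.

Let thetaD p q : theta (p + q) = theta p + theta q.
Proof. by rewrite /theta rmorphD hornerD. Qed.

Let thetaM p q : theta (p * q) = theta p * theta q.
Proof. by rewrite /theta rmorphM hornerM. Qed.

Let thetaC a : theta a%:P = a%:MP.
Proof. by rewrite /theta map_polyC hornerC. Qed.

Let thetaX : theta 'X = Tvar k i 0.
Proof. by rewrite /theta map_polyX hornerX. Qed.

(** As F_0 is nonzero, this substitution is injective: the Rees algebra has no equation in T_0
    alone. *)
Let theta_eval p : rees_eval (theta p) = p \Po (Fsol 0 *: 'X).
Proof.
elim/poly_ind: p => [|p a IH]; first by rewrite comp_poly0 theta0 rees_eval0.
rewrite thetaD thetaM thetaX thetaC rees_evalD rees_evalM IH.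
rewrite (rees_evalC a) (rees_eval_Tvar (leq0n _)).
by rewrite comp_polyD comp_polyM comp_polyX comp_polyC.
Qed.

(* Up to a power of [y_0], every element is congruent to a polynomial in [T_0] alone. *)
Let elim_T x := exists N p, ideal_gen Lg (yvar k s 0 ^+ N * x - theta p).

Let elim_T_ideal x : ideal_gen Lg x -> elim_T x.
Proof.
by move=> Ix; exists 0%N, 0; rewrite mul1r theta0 subr0.
Qed.

Let elim_TC a : elim_T a%:MP.
Proof.
exists 0%N, a%:P; rewrite thetaC mul1r subrr; by case: (ideal_genP Lg).
Qed.

Let yvarX N : yvar k s 0 ^+ N = theta (yR 0 ^+ N)%:P.
Proof. by rewrite thetaC rmorphXn. Qed.

Let elim_TD x z : elim_T x -> elim_T z -> elim_T (x + z).
Proof.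
move=> [N [p Hp]] [M [q Hq]]; case: (ideal_genP Lg) => _ ID IM.
exists (N + M)%N, ((yR 0 ^+ M)%:P * p + (yR 0 ^+ N)%:P * q).
rewrite thetaD !thetaM -!yvarX.
move: (ID _ _ (IM (yvar k s 0 ^+ M) _ Hp) (IM (yvar k s 0 ^+ N) _ Hq)).
by congr (ideal_gen _ _); rewrite exprD; ring.
Qed.

Let elim_TM x z : elim_T x -> elim_T z -> elim_T (x * z).
Proof.
move=> [N [p Hp]] [M [q Hq]]; case: (ideal_genP Lg) => _ ID IM.
exists (N + M)%N, (p * q).
rewrite !thetaM.
move: (ID _ _ (IM (yvar k s 0 ^+ M * z) _ Hp) (IM (theta p) _ Hq)).
by congr (ideal_gen _ _); rewrite exprD; ring.
Qed.

Let elim_T_y0 x : elim_T (yvar k s 0 * x) -> elim_T x.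
Proof. by move=> [N [p Hp]]; exists N.+1, p; rewrite exprSr -mulrA. Qed.

(** The form L_b expresses y_0 T_b through T variables of smaller index, its leading weight being
    invertible. *)
Let elim_T_Tvar b : (b <= i)%N -> elim_T (Tvar k i b).
Proof.
elim/ltn_ind: b => -[|b] IH le_b.
  exists 0%N, 'X; rewrite thetaX mul1r subrr; by case: (ideal_genP Lg).
apply: elim_T_y0.
have cz : (c 0%N b.+1)%:~R != 0 :> k by apply: c_neq0.
pose u : S := (((c 0%N b.+1)%:~R^-1)%:MP)%:MP.
have uc : u * (c 0%N b.+1)%:~R = 1.
  rewrite -(rmorph_int (@mpolyC i.+1 R)) -(rmorph_int (@mpolyC i.+1 k)).
  by rewrite -!rmorphM mulVf // !rmorph1.
rewrite -[_ * _]mul1r -uc -mulrA; apply: elim_TM; first exact: elim_TC.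
have /esym/(canRL (addrK _)) -> := lform_recl c (yvar k s) (Tvar k i) b.+1.
apply: elim_TD; first exact: (elim_T_ideal (ideal_gen_gen Lg (Ordinal le_b))).
rewrite -sumrN; elim/big_ind: _ => [||a _].
- by apply: elim_T_ideal; case: (ideal_genP Lg).
- exact: elim_TD.
rewrite -mulNr -(rmorph_int (@mpolyC i.+1 R)) -rmorphN.
by apply: elim_TM; [apply: elim_TC | apply: elim_TM; [apply: elim_TC | apply: IH; lia]].
Qed.

Let elim_T_all x : elim_T x.
Proof.
elim/mpolyind: x => [|a m p _ _ IH].
  by apply: elim_T_ideal; case: (ideal_genP Lg).
apply: elim_TD => //; rewrite -mul_mpolyC; apply: elim_TM; first exact: elim_TC.
rewrite mpolyXE_id; elim/big_ind: _ => [|u v|j _].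
- exact: elim_TC.
- exact: elim_TM.
elim: (m j) => [|d Hd]; first exact: elim_TC.
rewrite exprS; apply: elim_TM => //.
by rewrite -[j]inord_val; apply: elim_T_Tvar; rewrite -ltnS.
Qed.

(** A multiple y_0^N x is congruent to a polynomial in T_0, which must vanish; then y_0^N is
    cancelled modulo the forms L_n. *)
Theorem rees_eval_ker x : rees_eval x = 0 -> ideal_gen Lg x.
Proof.
move=> x0; have [N [p Hp]] := elim_T_all x.
move: (Hp) => /rees_eval_ideal; rewrite rmorphB /= rees_evalM x0 mulr0 sub0r theta_eval.
move/eqP; rewrite oppr_eq0 comp_poly_eq0 => [/eqP p0|]; last first.
  by rewrite size_scale ?Fsol0_neq0 // size_polyX.
move: Hp; rewrite p0 theta0 subr0.
exact: (yvar_regular sK rkK).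
Qed.

End ReesRelations.

(** * The Rees algebra as symmetric algebra *)

Section LinearType.
Variables (A : comNzRingType) (n m : nat) (g : 'I_n -> A) (M : 'I_m -> 'I_n -> A).
Definition linear_forms (j : 'I_m) : {mpoly A[n]} := \sum_b (M j b)%:MP * 'X_b.

Hypothesis Mg : forall j, \sum_b M j b * g b = 0.
Hypothesis rees_ker : forall H, rees_map g H = 0 -> ideal_gen linear_forms H.

Local Notation E := (ideal_module g).

Lemma rees_iota_mem (e : E) : rees_mem g ((ideal_incl g e : A) *: 'X).
Proof.
have /ideal_memP[a ea] := valP e; apply/rees_memP.
exists (\sum_j (a j)%:MP * 'X_j).
rewrite rmorph_sum [ideal_incl g e]ea scaler_suml; apply: eq_bigr => j _.
by rewrite rmorphM /= rees_mapC rees_mapX mul_polyC scalerA.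
Qed.

Definition rees_iota (e : E) : rees g := exist (rees_mem g) _ (rees_iota_mem e).

Definition rees_val : rees g -> {poly A} := \val.
HB.instance Definition _ := GRing.Linear.on rees_val.
HB.instance Definition _ := GRing.RMorphism.on rees_val.

Lemma rees_valZ a s : rees_val (a *: s) = a *: rees_val s.
Proof. exact: linearZ. Qed.

Lemma rees_iota_zmod : zmod_morphism rees_iota.
Proof.
move=> e1 e2; apply: val_inj; rewrite [RHS](raddfB rees_val).
rewrite -[LHS]/((ideal_incl g (e1 - e2) : A) *: 'X).
by rewrite (linearB (ideal_incl g)) scalerBl.
Qed.
HB.instance Definition _ := GRing.isZmodMorphism.Build E (rees g) rees_iota rees_iota_zmod.

Lemma rees_iota_scalable : scalable rees_iota.
Proof.
move=> a e; apply: val_inj; rewrite [RHS]rees_valZ.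
rewrite -[LHS]/((ideal_incl g (a *: e) : A) *: 'X).
by rewrite linearZ -scalerA.
Qed.
HB.instance Definition _ :=
  GRing.isScalable.Build A E (rees g) _ rees_iota rees_iota_scalable.

Section Universal.
Variables (B : comAlgType A) (phi : {linear E -> B}).

Definition poly_eval : {mpoly A[n]} -> B :=
  mmap (in_alg B) (fun j => phi (ideal_module_gen g j)).
HB.instance Definition _ := GRing.RMorphism.on poly_eval.

Lemma poly_evalC a : poly_eval a%:MP = a%:A.
Proof. by rewrite /poly_eval mmapC. Qed.

Lemma poly_evalX j : poly_eval 'X_j = phi (ideal_module_gen g j).
Proof. by rewrite /poly_eval mmapX mmap1U. Qed.

Lemma poly_eval_lin (a : 'I_n -> A) :
  poly_eval (\sum_j (a j)%:MP * 'X_j) = phi (\sum_j a j *: ideal_module_gen g j).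
Proof.
rewrite rmorph_sum linear_sum; apply: eq_bigr => j _.
by rewrite rmorphM /= poly_evalC poly_evalX mulr_algl linearZ.
Qed.

(** The equations of the Rees algebra are generated by linear ones, and any linear map on the ideal
    respects these, since they are syzygies of g. Evaluation therefore factors through the Rees
    algebra. *)
Lemma poly_eval_ker H : rees_map g H = 0 -> poly_eval H = 0.
Proof.
move=> /rees_ker; apply: (ideal_gen_sub (ker_ideal poly_eval)) => j.
rewrite [LHS]poly_eval_lin -[RHS](linear0 phi); congr (phi _); apply: val_inj.
rewrite -[LHS]/(ideal_incl g _) linear_sum -[RHS](Mg j).
by apply: eq_bigr => b _; rewrite linearZ.
Qed.

Lemma poly_eval_eq H K : rees_map g H = rees_map g K -> poly_eval H = poly_eval K.
Proof.
move=> e; apply/eqP; rewrite -subr_eq0 -rmorphB; apply/eqP/poly_eval_ker.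
by rewrite rmorphB /= e subrr.
Qed.

Definition rees_lift (s : rees g) : {mpoly A[n]} := projT1 (cid (rees_memP _ _ (valP s))).

Lemma rees_liftE s : rees_map g (rees_lift s) = val s.
Proof. by rewrite /rees_lift; case: cid. Qed.

Definition rees_univ (s : rees g) : B := poly_eval (rees_lift s).

Lemma rees_univE s H : rees_map g H = val s -> rees_univ s = poly_eval H.
Proof. by move=> e; apply: poly_eval_eq; rewrite rees_liftE. Qed.

Lemma rees_univ_zmod : zmod_morphism rees_univ.
Proof.
move=> s t; rewrite (@rees_univE _ (rees_lift s - rees_lift t)) ?rmorphB //=.
by rewrite !rees_liftE.
Qed.
HB.instance Definition _ := GRing.isZmodMorphism.Build (rees g) B rees_univ rees_univ_zmod.

Lemma rees_univ_monoid : monoid_morphism rees_univ.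
Proof.
split=> [|s t]; first by rewrite (@rees_univE _ 1) ?rmorph1.
rewrite (@rees_univE _ (rees_lift s * rees_lift t)) ?rmorphM //=.
by rewrite !rees_liftE.
Qed.
HB.instance Definition _ := GRing.isMonoidMorphism.Build (rees g) B rees_univ rees_univ_monoid.

Lemma rees_univ_scalable : scalable rees_univ.
Proof.
move=> a s; rewrite (@rees_univE _ (a%:MP * rees_lift s)).
  by rewrite rmorphM /= poly_evalC mulr_algl.
by rewrite rmorphM /= rees_liftE rees_mapC mul_polyC.
Qed.
HB.instance Definition _ :=
  GRing.isScalable.Build A (rees g) B _ rees_univ rees_univ_scalable.

Lemma rees_univ_iota e : rees_univ (rees_iota e) = phi e.
Proof.
have [a ea] := ideal_moduleE e.
rewrite (@rees_univE _ (\sum_j (a j)%:MP * 'X_j)) ?poly_eval_lin -?ea //.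
rewrite -[RHS]/((ideal_incl g e : A) *: 'X) ea rmorph_sum linear_sum scaler_suml.
apply: eq_bigr => j _.
by rewrite rmorphM /= rees_mapC rees_mapX mul_polyC; apply: scalerA.
Qed.

End Universal.

(** With the Rees algebra itself as symmetric algebra, the injectivity asked for in [linear_type] is
    that of an inclusion. *)
Lemma rees_sym_algebra : is_sym_algebra rees_iota.
Proof.
move=> B phi; exists (rees_univ phi); split=> [e|h' h'_iota s].
  exact: rees_univ_iota.
have e H : val (poly_eval rees_iota H) = rees_map g H.
  apply: (mpoly_rmorph_eq (f := rees_val \o poly_eval rees_iota) (g := rees_map g)) => [a|j] /=.
    by rewrite poly_evalC rees_mapC [LHS]rees_valZ (rmorph1 rees_val) alg_polyC.
  by rewrite poly_evalX rees_mapX.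
have es : poly_eval rees_iota (rees_lift s) = s by apply: val_inj; rewrite e rees_liftE.
rewrite -{1}es -[RHS]/(poly_eval phi (rees_lift s)); move: (rees_lift s).
apply: (mpoly_rmorph_eq (f := h' \o poly_eval rees_iota) (g := poly_eval phi)) => [a|j] /=.
  by rewrite !poly_evalC linearZ rmorph1.
by rewrite !poly_evalX h'_iota.
Qed.

Theorem linear_type_of_rees : linear_type (ideal_gen g).
Proof.
exists E, (ideal_incl g), (rees g), rees_iota, rees_val; split.
- split=> [|x]; first exact: val_inj.
  split=> [/ideal_memP Ix|[e <-]]; last exact/ideal_memP/(valP e).
  by exists (exist _ x Ix).
- exact: rees_sym_algebra.
- by [].
exact: val_inj.
Qed.

End LinearType.

(** * Projective dimension *)

Section FreeModules.
Variables (A : comNzRingType) (n : nat).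

Section Lincomb.
Variables (V : lmodType A) (x : 'I_n -> V).
Definition lincomb (v : 'rV[A]_n) : V := \sum_b v 0 b *: x b.
Lemma lincomb_linear : linear lincomb.
Proof.
move=> a u v; rewrite /lincomb scaler_sumr -big_split; apply: eq_bigr => b _.
by rewrite !mxE scalerDl scalerA.
Qed.
HB.instance Definition _ := GRing.isLinear.Build A 'rV[A]_n V _ lincomb lincomb_linear.

End Lincomb.

Lemma projective_rV : projective 'rV[A]_n.
Proof.
move=> M N g f g_surj.
have /choice[x gx] : forall b : 'I_n, exists x, g x = f (delta_mx 0 b) by move=> b.
exists (lincomb x : {linear _ -> _}) => v /=.
rewrite {2}[v]row_sum_delta linear_sum linear_sum.
by apply: eq_bigr => b _; rewrite !linearZ /= gx.
Qed.

End FreeModules.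

Section ScaleMap.
Variables (A : comNzRingType) (V : lmodType A) (x : V).
Definition scale_map (a : A^o) : V := (a : A) *: x.
Lemma scale_map_linear : linear scale_map.
Proof. by move=> a u v; rewrite /scale_map scalerDl scalerA. Qed.
HB.instance Definition _ := GRing.isLinear.Build A A^o V _ scale_map scale_map_linear.
End ScaleMap.

Lemma projective_regular (A : comNzRingType) : projective A^o.
Proof.
move=> M N g f g_surj; have [x gx] := g_surj (f 1).
exists (scale_map x : {linear _ -> _}) => a /=.
by rewrite /scale_map linearZ gx -linearZ; congr (f _); apply: mulr1.
Qed.

Section HilbertBurch.
Variables (A : idomainType) (n m : nat) (g : 'I_n -> A) (M : 'I_m -> 'I_n -> A).
Local Notation Q := (ideal_quotient g).

Hypothesis Mg : forall j, \sum_b M j b * g b = 0.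
Hypothesis syz : forall v : 'I_n -> A, \sum_b v b * g b = 0 ->
  exists a : 'I_m -> A, forall b, v b = \sum_j a j * M j b.
Hypothesis M_free : forall a : 'I_m -> A, (forall b, \sum_j a j * M j b = 0) ->
  forall j, a j = 0.

Definition res_mod (j : nat) : lmodType A :=
  match j with 0 => A^o | 1 => 'rV[A]_n | 2 => 'rV[A]_m | _ => 'rV[A]_0 end.

Definition res_map (j : nat) : {linear res_mod j.+1 -> res_mod j} :=
  match j with
  | 0 => lincomb (g : 'I_n -> A^o)
  | 1 => mulmxr (\matrix_(j, b) M j b)
  | 2 => \0%R
  | _ => \0%R
  end.

Lemma proj_dim_le_quotient : proj_dim_le Q 2.
Proof.
exists res_mod, (ideal_proj g : {linear _ -> _}), res_map; split.
- split=> [[|[|[|j]]]|[|[|[|j]]] //= _ x].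
  + exact: projective_regular.
  + exact: projective_rV.
  + exact: projective_rV.
  + exact: projective_rV.
  by apply/rowP => -[].
- by case: (ideal_proj_quotient g).
- move=> x; rewrite ideal_proj_eq0; split=> [[a ->]|[v <-]].
    by exists (\row_b a b); rewrite /= /lincomb; apply: eq_bigr => b _; rewrite mxE.
  by exists (v 0).
case=> [|[|[|j]]] x /=.
- split=> [x0|[v <-]].
    have [a ea] := syz x0; exists (\row_j a j); apply/rowP => b.
    by rewrite !mxE ea; apply: eq_bigr => j _; rewrite !mxE.
  suff: \sum_b (v *m \matrix_(j, b) M j b) 0 b * g b = 0 by [].
  under eq_bigr do rewrite !mxE mulr_suml.
  rewrite exchange_big big1 // => j _ /=.
  under eq_bigr do rewrite mxE -mulrA.
  by rewrite -mulr_sumr Mg mulr0.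
- split=> [x0|[v <-]]; last by rewrite mul0mx.
  exists 0; suff -> : x = 0 by [].
  apply/rowP => j; rewrite [RHS]mxE; move: j; apply: M_free => b.
  move/rowP: x0 => /(_ b); rewrite !mxE => x0; rewrite -[RHS]x0.
  by apply: eq_bigr => j _; rewrite mxE.
- split=> // _; exists 0; by apply/rowP => -[].
- split=> // _; exists 0; by apply/rowP => -[].
Qed.

Section IdealLift.
Variables (V : lmodType A) (t : {linear V -> A^o}).
Hypothesis tI : forall z, ideal_gen g (t z).

Lemma ideal_lift_mem z : ideal_mem g (t z). Proof. exact/ideal_memP. Qed.

Definition ideal_lift (z : V) : ideal_module g := exist _ (t z) (ideal_lift_mem z).

Lemma ideal_lift_linear : linear ideal_lift.
Proof.
move=> a u v; apply: val_inj; rewrite [RHS](linearP (ideal_incl g)).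
by rewrite -[LHS]/(t _) linearP.
Qed.
HB.instance Definition _ :=
  GRing.isLinear.Build A V (ideal_module g) _ ideal_lift ideal_lift_linear.
End IdealLift.

Variables p q : 'I_n.
Hypothesis gp0 : g p != 0.
Hypothesis gpq : forall b u, g q * b = g p * u -> exists v, b = g p * v.
Hypothesis g1 : ~ ideal_gen g 1.

(* A resolution of length one makes the ideal projective: multiplication by some
   [c = 1] modulo the ideal factors as [x |-> sum_j s_j(x) g_j] with linear forms
   [s_j]. As [g_q s_j(g_p) = g_p s_j(g_q)], coprimality gives [s_j(g_p) = g_p v_j],
   whence [c = sum_j v_j g_j] and 1 is in the ideal. *)
Lemma proj_dim_ge_quotient d : proj_dim_le Q d -> (2 <= d)%N.
Proof.
case=> P [eps [dd [[Pproj Pzero] eps_surj ex0 ex]]].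
rewrite leqNgt; apply/negP => lt_d2.
have dd_inj z : dd 0%N z = 0 -> z = 0.
  by case/ex => z' <-; rewrite (Pzero 2%N lt_d2 z') linear0.
have [pi_surj pi0] := ideal_proj_quotient g.
have [w ew] := Pproj 0%N _ _ (ideal_proj g : {linear _ -> _}) eps pi_surj.
have [p0 ep0] := eps_surj (ideal_proj g 1).
(* As [p0] lifts 1, each g_l [p0] is in the kernel of [eps] and comes from P_1; the linear forms s_j
   are evaluated at g_l through these preimages [z l]. *)
have /choice[z ez] (l : 'I_n) : exists z, dd 0%N z = g l *: p0.
  apply/ex0; rewrite linearZ /= ep0 -[LHS]linearZ; apply/ideal_proj_eq0.
  by rewrite -[_ *: 1]/(g l * 1) mulr1; apply: ideal_gen_gen.
have tI x : ideal_gen g ((w \o dd 0%N) x).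
  by apply/ideal_proj_eq0; rewrite /= ew; apply/ex0; exists x.
have gen_surj y : exists x, lincomb (ideal_module_gen g) x = y.
  have [a ->] := ideal_moduleE y; exists (\row_j a j).
  by rewrite /lincomb; apply: eq_bigr => j _; rewrite mxE.
have [beta ebeta] := Pproj 1%N _ _ (lincomb (ideal_module_gen g) : {linear _ -> _})
  (ideal_lift tI : {linear _ -> _}) gen_surj.
have sum_beta x : \sum_j beta x 0 j * g j = w (dd 0%N x).
  have := congr1 (ideal_incl g) (ebeta x); rewrite [X in _ = X -> _]/= => <-.
  by rewrite linear_sum; apply: eq_bigr => j _; rewrite linearZ.
have bpq j : g q * beta (z p) 0 j = g p * beta (z q) 0 j.
  have zz : g q *: z p = g p *: z q.
    apply/eqP; rewrite -subr_eq0; apply/eqP/dd_inj.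
    by rewrite linearB !linearZ /= !ez scalerN !scalerA [g q * _]mulrC subrr.
  by have := congr1 (fun x => beta x 0 j) zz; rewrite !linearZ !mxE.
have /choice[v ev] (j : 'I_n) : exists v, beta (z p) 0 j = g p * v.
  exact: gpq (bpq j).
pose c : A := w p0.
have ec : c = \sum_j v j * g j.
  apply: (mulfI gp0); rewrite mulr_sumr.
  transitivity (w (dd 0%N (z p)) : A); first by rewrite ez linearZ.
  by rewrite -sum_beta; apply: eq_bigr => j _; rewrite ev mulrA.
apply: g1; rewrite -(subrK c 1); case: (ideal_genP g) => _ ID _; apply: ID.
  by apply/ideal_proj_eq0; rewrite linearB /= ew ep0 subrr.
by rewrite ec; exists v.
Qed.

Theorem perfect_quotient : codim (ideal_gen g) 2 -> perfect_of_codim (ideal_gen g) 2.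
Proof.
move=> cod; split=> //; exists Q, (ideal_proj g : {linear _ -> _}).
split; first exact: ideal_proj_quotient.
split; [exact: proj_dim_le_quotient | exact: proj_dim_ge_quotient].
Qed.

End HilbertBurch.

(** * Krull dimension of polynomial rings *)

Section AlgebraicDependence.
Variables (k : fieldType) (n : nat) (h : 'I_n.+1 -> {mpoly k[n]}).

(** [B] bounds the size of a monomial in h with exponents below [N]. The constant [c] is chosen so
    that B <= N c, and [N] exceeds c^n, whence B^n <= N^n c^n < N^(n+1). *)
Let D := (\max_j msize (h j))%N.
Let c := (n.+1 * D).+1.
Let N := (c ^ n).+1.
Let B := (n.+1 * N * D).+1.

Let msizeM_bound (p q : {mpoly k[n]}) d e :
  (msize p <= d.+1 -> msize q <= e.+1 -> msize (p * q) <= (d + e).+1)%N.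
Proof.
have [->|p0] := eqVneq p 0; first by rewrite mul0r msize0.
have [->|q0] := eqVneq q 0; first by rewrite mulr0 msize0.
by rewrite msizeM //; move: (msize p) (msize q) => a b; lia.
Qed.

Let msizeX_le (p : {mpoly k[n]}) d e : (msize p <= d.+1 -> msize (p ^+ e) <= (d * e).+1)%N.
Proof.
move=> le_p; elim: e => [|e IH]; first by rewrite msize1.
by rewrite exprS mulnS; apply: msizeM_bound.
Qed.

Let monom (e : {ffun 'I_n.+1 -> 'I_N}) : {mpoly k[n]} := \prod_j h j ^+ e j.

Let monom_size e : (msize (monom e) <= B)%N.
Proof.
suff : (msize (monom e) <= (\sum_j D * e j).+1)%N.
  move/leq_trans; apply; rewrite ltnS.
  apply: (@leq_trans (\sum_(j < n.+1) N * D)); last by rewrite sum_nat_const card_ord mulnA.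
  by apply: leq_sum => j _; rewrite mulnC leq_mul2r ltnW ?orbT.
rewrite /monom; elim/big_rec2: _ => [|j p d _ le_p]; first by rewrite msize1.
apply: msizeM_bound => //; apply/msizeX_le/leqW.
exact: (leq_bigmax (F := fun j => msize (h j))).
Qed.

Let coef_mx : 'M[k]_(#|{: {ffun 'I_n.+1 -> 'I_N}}|, #|{: {ffun 'I_n -> 'I_B}}|) :=
  \matrix_(e, m) (monom (enum_val e))@_
    [multinom ((enum_val m : {ffun 'I_n -> 'I_B}) j : nat) | j < n].

Let count_lt : (#|{: {ffun 'I_n -> 'I_B}}| < #|{: {ffun 'I_n.+1 -> 'I_N}}|)%N.
Proof.
rewrite !card_ffun !card_ord.
apply: (@leq_ltn_trans ((N * c) ^ n)); first last.
  by rewrite expnMn expnSr ltn_pmul2l ?expn_gt0.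
have le_B : (B <= N * c)%N by rewrite /B /c; nia.
by elim: (X in (_ ^ X <= _ ^ X)%N) => // d IH; rewrite !expnS leq_mul.
Qed.

(* There are N^(n+1) monomials in [h] with exponents below N, in a space of
   dimension O(N^n). *)
Theorem algebraic_dependence :
  exists Q : {mpoly k[n.+1]}, Q != 0 /\ mmap (@mpolyC n k) h Q = 0.
Proof.
have : kermx coef_mx != 0.
  rewrite -mxrank_eq0 mxrank_ker -lt0n subn_gt0.
  exact: leq_ltn_trans (rank_leq_col _) count_lt.
case/rowV0Pn => v /sub_kermxP v_ker v0.
pose mon (e : {ffun 'I_n.+1 -> 'I_N}) := [multinom (e j : nat) | j < n.+1].
have mon_inj : injective mon.
  move=> e e' /mnmP eq_e; apply/ffunP => j; apply: val_inj.
  by have := eq_e j; rewrite !mnmE.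
exists (\sum_e v 0 e *: 'X_[mon (enum_val e)]); split.
  apply/eqP => Q0; case/rV0Pn: v0 => e0; apply/negP; rewrite negbK; apply/eqP.
  have := congr1 (mcoeff (mon (enum_val e0))) Q0.
  rewrite raddf_sum (bigD1 e0) //= big1 => [|e ne_e].
    by rewrite mcoeffZ mcoeffX eqxx mulr1 addr0 mcoeff0.
  rewrite mcoeffZ mcoeffX; case: eqP => [/mon_inj/enum_val_inj e_e0|_]; last by rewrite mulr0.
  by rewrite e_e0 eqxx in ne_e.
rewrite raddf_sum.
have -> : \sum_e mmap (@mpolyC n k) h (v 0 e *: 'X_[mon (enum_val e)])
    = \sum_e v 0 e *: monom (enum_val e).
  apply: eq_bigr => e _; rewrite mmapZ mmapX mul_mpolyC; congr (_ *: _).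
  by apply: eq_bigr => j _; rewrite mnmE.
apply/mpolyP => m; rewrite mcoeff0 raddf_sum /=.
have [lt_m|ge_m] := ltnP (mdeg m) B; last first.
  rewrite big1 // => e _; rewrite mcoeffZ memN_msupp_eq0 ?mulr0 //.
  by apply: msize_mdeg_ge; apply: leq_trans ge_m; apply: monom_size.
have lt_mj j : (m j < B)%N.
  by apply: leq_ltn_trans lt_m; rewrite mdegE (bigD1 j) //= leq_addr.
pose f : {ffun 'I_n -> 'I_B} := [ffun j => Ordinal (lt_mj j)].
move/rowP: v_ker => /(_ (enum_rank f)); rewrite !mxE => v_ker; rewrite -[RHS]v_ker.
apply: eq_bigr => e _; rewrite mcoeffZ mxE; congr (_ * _@__).
by apply/mnmP => j; rewrite mnmE enum_rankK ffunE.
Qed.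

End AlgebraicDependence.

Lemma prime_ideal_exp (A : comNzRingType) (P : A -> Prop) x n :
  is_prime_ideal P -> P (x ^+ n) -> P x.
Proof.
move=> [_ P1 PM]; elim: n => [|n IH]; first by rewrite expr0 => /P1.
by rewrite exprS => /PM[//|/IH].
Qed.

Lemma height_ge_pred (A : comNzRingType) (P : A -> Prop) h : height_ge P h.+1 -> height_ge P h.
Proof.
move=> [C [Cprime Cinc Cend]]; exists (fun j => C j.+1); split=> // [j le_j|j lt_j].
  exact: Cprime.
exact: Cinc.
Qed.

Lemma height_ge_le (A : comNzRingType) (P : A -> Prop) h h' :
  (h <= h')%N -> height_ge P h' -> height_ge P h.
Proof.
by move=> le_h; rewrite -(subnK le_h); elim: (h' - h)%N => //= d IH /height_ge_pred.
Qed.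

Section KrullDimension.
Variables (k : fieldType) (n : nat).
Local Notation Z := (@kill k n (fun v : 'I_n.+1 => v : nat)).

Let Z_all (Q : {mpoly k[n.+1]}) : Z n.+1 Q = (Q@_0%MM)%:MP.
Proof.
apply: (mpoly_rmorph_eq (f := Z n.+1) (g := @mpolyC n.+1 k \o mcoeff 0%MM)) => [a|v] /=.
  by rewrite killC mcoeffC eqxx mulr1.
by rewrite killX ltn_ord mcoeffX mnm1_eq0 mpolyC0.
Qed.

(* A polynomial relation Q(h_0, ..., h_n) in C_0 among elements h_j in C_(j+1) but not in
   C_j gives, after division by a power of T_0, a relation Q(0, h_1, ..., h_n) in C_1, etc. *)
Theorem krull_dim_le (P : {mpoly k[n]} -> Prop) : ~ height_ge P n.+1.
Proof.
move=> [C [Cprime Cinc _]].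
have /choice[h hP] (j : 'I_n.+1) : exists x, C j.+1 x /\ ~ C j x.
  have [_] := Cinc j (ltn_ord j); rewrite /subideal => /existsNP[x].
  by rewrite not_implyP; exists x.
pose phi : {rmorphism {mpoly k[n.+1]} -> {mpoly k[n]}} := mmap (@mpolyC n k) h.
have phiX j : phi 'X_j = h j by rewrite /phi /= mmapX mmap1U.
(* [Z j Q = Q] says that Q involves only T_j, ..., T_n. The outer induction is on the number of
   these variables, the inner one on the size of Q; when none is left, Q is a nonzero constant in a
   proper ideal. *)
have Z_rel j d Q : (j <= n.+1)%N -> Q != 0 -> Z j Q = Q -> (msize Q < d)%N ->
    C j (phi Q) -> False.
  elim: {j}(n.+1 - j)%N {-2}j (erefl (n.+1 - j)%N) d Q => [|e IHe] j ej d Q.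
    move=> le_j Q0 ZQ _; have j_n : j = n.+1 by lia.
    move: ZQ; rewrite [in Z j]j_n Z_all => eQ.
    have c0 : Q@_0%MM != 0 by apply: contraNneq Q0 => Q00; rewrite -eQ Q00 mpolyC0.
    rewrite -eQ /= mmapC => CQ; have [[_ _ CM] C1 _] := Cprime j le_j.
    apply: C1; have -> : 1 = ((Q@_0%MM)^-1)%:MP * (Q@_0%MM)%:MP :> {mpoly k[n]}.
      by rewrite -mpolyCM mulVf.
    exact: CM.
  elim: d Q => // d IHd Q le_j Q0 ZQ lt_d CQ.
  have lt_j : (j < n.+1)%N by lia.
  have [Cj1 CjN] := hP (Ordinal lt_j).
  have [g] : exists g, Z j Q - Z j.+1 Q = 'X_(inord j) * g.
    by apply: kill_mod => // v; apply: inord_val.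
  have -> : inord j = Ordinal lt_j by apply: val_inj; rewrite /= inordK.
  rewrite ZQ => eg.
  (* If Q survives T_j = 0, the relation passes to C_(j+1), which contains C_j and h_j. Otherwise
     T_j divides Q and is cancelled, because C_j is prime and does not contain h_j. *)
  have [Q'0|Q'0] := eqVneq (Z j.+1 Q) 0; last first.
    apply: (IHe j.+1 _ (msize (Z j.+1 Q)).+1 (Z j.+1 Q)) => //; first by lia.
      by rewrite kill_comp.
    have [[_ CD CM] _ _] := Cprime j.+1 lt_j; have [Csub _] := Cinc j lt_j.
    have -> : Z j.+1 Q = Q + (- g) * 'X_(Ordinal lt_j) by rewrite mulNr mulrC -eg; ring.
    rewrite rmorphD rmorphM /= -/(phi _) (phiX (Ordinal lt_j)).
    by apply: CD; [apply: Csub | apply: CM].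
  move: eg; rewrite Q'0 subr0 => eg.
  have eZ : Q = 'X_(Ordinal lt_j) * Z j g.
    by rewrite -[LHS]ZQ eg rmorphM /= killX ltnn.
  have Zg0 : Z j g != 0 by apply: contraNneq Q0 => Zg0; rewrite eZ Zg0 mulr0.
  apply: (IHd (Z j g)) => //.
  - by rewrite kill_comp.
  - move: lt_d; rewrite eZ msizeM // ?(mpolyX_neq0 k) // msizeX mdeg1.
    by move: (msize _) => a; lia.
  have [_ _ Cpr] := Cprime j le_j.
  by move: CQ; rewrite eZ rmorphM (phiX (Ordinal lt_j)) => /Cpr[].
have [Q [Q0 phiQ]] := algebraic_dependence h.
apply: (Z_rel 0%N (msize Q).+1 Q) => //.
  apply: (mpoly_rmorph_eq (f := Z 0) (g := idfun)) => [a|v] /=; first by rewrite killC.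
  by rewrite killX.
by have [[C0 _ _] _ _] := Cprime 0%N isT; rewrite -[phi Q]/(mmap _ _ _) phiQ.
Qed.

End KrullDimension.

(** * Codimension of the base ideal *)

Section Codimension.
Variables (k : fieldType) (i : nat) (s : nat -> 'I_i.+1) (rk : 'I_i.+1 -> nat).
Hypothesis sK : forall a, (a <= i)%N -> rk (s a) = a.
Hypothesis rkK : forall v, s (rk v) = v.
Variable c : nat -> nat -> int.
Hypothesis c_neq0 : forall a b, (0 < a + b)%N -> (c a b)%:~R != 0 :> k.
Hypothesis i_gt0 : (0 < i)%N.
Local Notation R := {mpoly k[i.+1]}.
Local Notation y := (@yR k i s).
Local Notation F := (@Fsol k i s c).

Definition vanishing (m : nat) (p : R) : Prop := kill rk m p = 0.

Lemma vanishing_prime m : is_prime_ideal (vanishing m).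
Proof.
split=> [||x z]; first exact: ker_ideal.
  by rewrite /vanishing rmorph1 => /eqP; rewrite oner_eq0.
rewrite /vanishing rmorphM => /eqP; rewrite mulf_eq0.
by case/orP=> /eqP ->; [left | right].
Qed.

Lemma kill_y m a : (a <= i)%N -> kill rk m (y a) = if (a < m)%N then 0 else y a.
Proof. by move=> le_a; rewrite killX sK. Qed.

Lemma vanishing_y m a : (a < m <= i.+1)%N -> vanishing m (y a).
Proof. by move=> lt_a; rewrite /vanishing kill_y ?ifT //; lia. Qed.

Lemma vanishing_yN m : (m <= i)%N -> ~ vanishing m (y m).
Proof.
move=> le_m; rewrite /vanishing kill_y // ltnn => /eqP.
by rewrite (negPf (mpolyX_neq0 k _)).
Qed.

Lemma kill0 (p : R) : kill rk 0 p = p.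
Proof.
apply: (mpoly_rmorph_eq (f := kill rk 0) (g := idfun)) => [a|v] /=; first by rewrite killC.
by rewrite killX.
Qed.

Lemma vanishing_sub m : (m <= i)%N ->
  subideal (vanishing m) (vanishing m.+1) /\ ~ subideal (vanishing m.+1) (vanishing m).
Proof.
move=> le_m; split=> [x|sub]; last first.
  by apply: (vanishing_yN le_m); apply/sub/vanishing_y; lia.
by rewrite /vanishing => xm; rewrite -(kill_comp rk x (leqnSn m)) xm rmorph0.
Qed.

(** A chain of length 3 ending at (y_0, y_1), continued by (y_0, y_1, y_2) and so on up to all
    variables, would have length i + 2 in a ring of dimension at most i + 1. *)
Lemma vanishing_height : prime_height (vanishing 2) 2.
Proof.
split.
  exists vanishing; split=> // [j _|j lt_j]; first exact: vanishing_prime.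
  by apply: vanishing_sub; lia.
move=> [C [Cprime Cinc Cend]].
apply: (@krull_dim_le k i.+1 (vanishing i.+1)).
exists (fun j => if (j <= 3)%N then C j else vanishing j.-1); split.
- move=> j le_j; case: leqP => le3; [exact: Cprime | exact: vanishing_prime].
- move=> j lt_j; have [lt3|] := ltnP j 3; first by rewrite ltnW //; apply: Cinc.
  rewrite leq_eqVlt => /predU1P[j3|lt3].
    have le2i : (2 <= i)%N by lia.
    have /= [sub23 nsub] := vanishing_sub le2i; rewrite -j3 /=.
    by split=> [x /Cend/sub23 //|sub]; apply: nsub => x /sub/Cend.
  rewrite leqNgt lt3; case: j lt_j lt3 => // j lt_j _; apply: vanishing_sub; lia.
move=> x; case: leqP => // le_i.
by have -> : i = 1%N by lia.
Qed.

Lemma Fsol_lead : exists u g, u != 0 /\ F i = u *: y 1 ^+ i + y 0 * g.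
Proof.
have [u [g [u0 e]]] := @esol_mod_y0 k i.+1 c y (fun n n0 => c_neq0 (a := 0) n0)
  (fun n => c_neq0 (a := 1) (b := n) isT) i.
by exists u, g; split=> //; rewrite /Fsol /asol subnn mul1r.
Qed.

Lemma Fsol_vanishing : subideal (ideal_gen (fun b : 'I_i.+1 => F b)) (vanishing 2).
Proof.
have [u [g [u0 eF]]] := Fsol_lead.
apply: ideal_gen_sub; first by case: (vanishing_prime 2).
have y0 : vanishing 2 (y 0) by apply: vanishing_y; lia.
have y1 : vanishing 2 (y 1) by apply: vanishing_y; lia.
have [[_ VD VM] _ _] := vanishing_prime 2.
move=> b; have [lt_b|] := ltnP b i.
  rewrite /Fsol /asol mulrC; apply: (VM).
  have -> : (i - b = (i - b).-1.+1)%N by lia.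
  by rewrite exprSr; apply: (VM).
move=> le_b; have -> : (b : nat) = i by have := ltn_ord b; lia.
rewrite eF; apply: VD; last by rewrite mulrC; apply: (VM).
have -> : y 1 ^+ i = y 1 ^+ i.-1 * y 1 by rewrite -exprSr prednK.
by rewrite -mul_mpolyC mulrA; apply: (VM).
Qed.

(** A prime containing the ideal contains y_0, as F_0 = y_0^i, and then y_1, as F_i is a nonzero
    multiple of y_1^i modulo y_0; so it lies strictly above 0 and (y_0). *)
Lemma codim_Fsol : codim (ideal_gen (fun b : 'I_i.+1 => F b)) 2.
Proof.
have [u [g [u0 eF]]] := Fsol_lead.
split.
  exists (vanishing 2); split; [exact: vanishing_prime | | exact: vanishing_height].
  exact: Fsol_vanishing.
move=> P h Pprime IP hP; rewrite leqNgt; apply/negP => lt_h.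
have P_y0 : P (y 0).
  apply: (prime_ideal_exp (n := i)) => //; rewrite -(Fsol0 k s c).
  exact: IP (ideal_gen_gen _ ord0).
have [[P0 PD PM] P1 Ppr] := Pprime.
have P_y1 : P (y 1).
  apply: (prime_ideal_exp (n := i)) => //.
  have -> : y 1 ^+ i = u^-1%:MP * (F i - g * y 0).
    have uu : u^-1%:MP * u%:MP = 1 :> R by rewrite -mpolyCM mulVf.
    by rewrite eF -mul_mpolyC; ring: uu.
  apply: (PM); apply: PD; last by rewrite -mulNr; apply: (PM).
  by have := ideal_gen_gen (fun b : 'I_i.+1 => F b) ord_max; apply: IP.
have ht2 : height_ge P 2.
  exists (fun j => if j is 0 then vanishing 0 else if j is 1 then vanishing 1 else P).
  split=> // [[|[|j]] // _|[|[|j]] // _]; try exact: vanishing_prime.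
    by apply: vanishing_sub.
  split=> [x Vx|sub].
    have [e] := kill_mod rkK x (leq0n i); rewrite Vx subr0 kill0 => ->.
    by rewrite mulrC; apply: (PM).
  by apply: (@vanishing_yN 1) => //; apply: sub.
by have [_] := hP; apply; apply: height_ge_le ht2; lia.
Qed.

End Codimension.

(** * The base ideals *)

Lemma ideal_gen_eq (A : comNzRingType) m n (g : 'I_m -> A) (h : 'I_n -> A) :
  (forall j, ideal_gen h (g j)) -> (forall j, ideal_gen g (h j)) ->
  ideal_gen g = ideal_gen h.
Proof.
move=> gh hg; apply/funext => x; apply/propext; split.
  exact: (ideal_gen_sub (ideal_genP h) gh).
exact: (ideal_gen_sub (ideal_genP g) hg).
Qed.

Section LformRows.
Variable A : comNzRingType.
(** The coefficient of T_b in L_n, extended by 0 for b > n so that the rows form a triangular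
    matrix. *)
Definition lrow (c : nat -> nat -> int) (y : nat -> A) (n b : nat) : A :=
  if (b <= n)%N then (c (n - b)%N b)%:~R * y (n - b)%N else 0.

Lemma lform_lrow c y T n N : (n <= N)%N ->
  lform c y T n = \sum_(b < N.+1) lrow c y n b * T b.
Proof.
move=> le_n; rewrite lformC /lform.
rewrite (big_ord_widen N.+1 (fun a => (c (n - a)%N a)%:~R * (T a * y (n - a)%N))) //.
rewrite big_mkcond; apply: eq_bigr => b _; rewrite /lrow ltnS; case: ifP => _.
  by ring.
by rewrite mul0r.
Qed.
End LformRows.

Section LinearFormCoefficients.
Variables (A : comNzRingType) (n : nat) (v : 'I_n -> A).
Let ell : {mpoly A[n]} := \sum_b (v b)%:MP * 'X_b.

Lemma linear_form_at0 : ell@_0%MM = 0.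
Proof.
rewrite /ell raddf_sum big1 // => b _ /=.
by rewrite mul_mpolyC mcoeffZ mcoeffX mnm1_eq0 mulr0.
Qed.

Lemma linear_form_deriv b : ell^`M(b) = (v b)%:MP.
Proof.
rewrite /ell raddf_sum (bigD1 b) //= big1 => [|l ne_l].
  rewrite mderiv_mulC mderivX mnm1E eqxx scale1r addr0 -[X in (X - _)%MM]add0m addmK.
  by rewrite mpolyX0 mulr1.
by rewrite mderiv_mulC mderivX mnm1E (negPf ne_l) scale0r mulr0.
Qed.

(** Reads off the part of degree one in the T variables: only the constant term of h contributes. *)
Lemma linear_form_mul_deriv (h : {mpoly A[n]}) b :
  (h * ell)^`M(b)@_0%MM = h@_0%MM * v b.
Proof.
rewrite mderivM raddfD /= !(rmorphM (mcoeff 0%MM)) /= linear_form_at0 mulr0 add0r.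
by rewrite linear_form_deriv mcoeffC eqxx mulr1.
Qed.
End LinearFormCoefficients.

Section BilinearIdeal.
Variables (k : fieldType) (i : nat) (s : nat -> 'I_i.+1) (rk : 'I_i.+1 -> nat).
Hypothesis sK : forall a, (a <= i)%N -> rk (s a) = a.
Hypothesis rkK : forall v, s (rk v) = v.
Variable c : nat -> nat -> int.
Hypothesis c_neq0 : forall a b, (0 < a + b)%N -> (c a b)%:~R != 0 :> k.
Hypothesis i_gt0 : (0 < i)%N.
Local Notation R := {mpoly k[i.+1]}.
Local Notation S := {mpoly R[i.+1]}.
Local Notation y := (@yR k i s).
Local Notation F := (@Fsol k i s c).
Let g (b : 'I_i.+1) : R := F b.
Let M (j : 'I_i) (b : 'I_i.+1) : R := lrow c y j.+1 b.

Let M_syz j : \sum_b M j b * g b = 0.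
Proof. by rewrite -(@lform_lrow R c y F j.+1 i) // lform_Fsol // ltn_ord. Qed.

Let Lgen_linear : Lgen k s c = linear_forms M.
Proof.
apply/funext => j.
have le_j : (j.+1 <= i)%N by [].
apply: (etrans (lform_lrow c (yvar k s) (Tvar k i) le_j)); apply: eq_bigr => b _.
rewrite /Tvar inord_val /M /lrow; case: ifP => _.
  by rewrite mpolyCM (rmorph_int (@mpolyC i.+1 R)).
by rewrite mpolyC0.
Qed.

Let rees_ker H : rees_map g H = 0 -> ideal_gen (linear_forms M) H.
Proof. by rewrite -Lgen_linear; apply: (rees_eval_ker sK rkK c_neq0). Qed.

Lemma linear_type_Fsol : linear_type (ideal_gen g).
Proof. exact: linear_type_of_rees M_syz rees_ker. Qed.

(** A syzygy is an equation of the Rees algebra that is linear in T; comparing parts of degree one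
    makes it a combination of the rows. *)
Let syz (v : 'I_i.+1 -> R) : \sum_b v b * g b = 0 ->
  exists a : 'I_i -> R, forall b, v b = \sum_j a j * M j b.
Proof.
move=> v0; have [|h eh] := @rees_ker (\sum_b (v b)%:MP * 'X_b).
  transitivity ((\sum_b v b * g b) *: 'X : {poly R}); last by rewrite v0 scale0r.
  rewrite rmorph_sum scaler_suml; apply: eq_bigr => b _.
  by rewrite rmorphM /= (rees_mapC g (v b)) rees_mapX mul_polyC scalerA.
exists (fun j => (h j)@_0%MM) => b.
have := congr1 (mcoeff 0%MM \o mderiv b) eh; rewrite /= linear_form_deriv.
rewrite mcoeffC eqxx mulr1 => ->.
rewrite (raddf_sum (mderiv b)) (raddf_sum (mcoeff 0%MM)); apply: eq_bigr => j _ /=.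
exact: linear_form_mul_deriv.
Qed.

(** Row j ends in column j + 1 with a nonzero multiple of y_0, so the coefficients vanish one by
    one, from the last row upwards. *)
Let M_free (a : 'I_i -> R) : (forall b, \sum_j a j * M j b = 0) -> forall j, a j = 0.
Proof.
move=> aM j; have [d] := ubnP (i - j); elim: d j => // d IH j lt_d.
have := aM (lift ord0 j); rewrite (bigD1 j) //= big1 ?addr0 => [|l ne_l].
  rewrite /M /lrow lift0 leqnn subnn; move/eqP; rewrite !mulf_eq0.
  rewrite (negPf (mpolyX_neq0 k _)) -(rmorph_int (@mpolyC i.+1 k)) mpolyC_eq0.
  by rewrite (negPf (c_neq0 _)) // !orbF => /eqP.
have [lt_lj|lt_jl|eq_lj] := ltngtP l j.
- by rewrite /M /lrow lift0 ifF ?mulr0 //; lia.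
- by rewrite IH ?mul0r //; have := ltn_ord l; lia.
by case/eqP: ne_l; apply: val_inj.
Qed.

(** Modulo the prime y_0, F_i is a nonzero multiple of y_1^i, so the factors y_0 must all divide
    p. *)
Lemma Fsol_coprime N p u : F i * p = y 0 ^+ N * u -> exists v, p = y 0 ^+ N * v.
Proof.
have [w [h [w0 eF]]] := Fsol_lead s c_neq0.
have F1 : kill rk 1 (F i) != 0.
  rewrite eF -mul_mpolyC rmorphD !rmorphM rmorphXn /= killC.
  rewrite (kill_y k sK 1 i_gt0) (kill_y k sK 1 (leq0n i)) /= mul0r addr0.
  by rewrite mulf_neq0 ?mpolyC_eq0 ?expf_neq0 // (mpolyX_neq0 k).
elim: N p u => [|N IH] p u; first by exists p; rewrite mul1r.
move=> e; have : kill rk 1 p = 0.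
  move/(congr1 (kill rk 1)): e; rewrite exprS -mulrA (rmorphM _ (F i)) (rmorphM _ (y 0)).
  rewrite /= (kill_y k sK 1 (leq0n i)) mul0r.
  by move/eqP; rewrite mulf_eq0 (negPf F1) => /eqP.
have [q] := kill_mod rkK p (leq0n i) => + p0; rewrite p0 subr0 kill0 => ep.
have [|v ev] := IH q u.
  by apply: (mulfI (mpolyX_neq0 k (s 0))); rewrite mulrCA -ep e exprS mulrA.
by exists v; rewrite ep ev exprS mulrA.
Qed.

Lemma perfect_Fsol : perfect_of_codim (ideal_gen g) 2.
Proof.
apply: (perfect_quotient M_syz syz M_free (p := ord0) (q := ord_max)).
- exact: Fsol0_neq0.
- by move=> p u; rewrite /g Fsol0; apply: Fsol_coprime.
- move/(Fsol_vanishing sK c_neq0 i_gt0).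
  by case: (vanishing_prime k rk 2).
exact: (codim_Fsol sK rkK c_neq0 i_gt0).
Qed.

Lemma Fsol_homog b : (b <= i)%N -> F b \is i.-homog.
Proof. by move=> le_b; apply: asol_homog => // a; rewrite dhomogX /= mdeg1. Qed.

End BilinearIdeal.

(** * The sub-Hankel determinant *)

Section AntiTriangular.
Variables (A : comNzRingType) (n : nat) (M : 'M[A]_n).
Let rev_perm : {perm 'I_n} := perm (@rev_ord_inj n).

Let det_rev_cols : \det (\matrix_(i, j) M i (rev_ord j)) = (-1) ^+ rev_perm * \det M.
Proof.
have -> : \matrix_(i, j) M i (rev_ord j) = col_perm rev_perm M.
  by apply/matrixP => i j; rewrite !mxE permE.
by rewrite col_permE det_mulmx det_perm odd_permV mulrC.
Qed.

Let det_rev d : (-1) ^+ rev_perm * \det M = d -> \det M = (-1) ^+ rev_perm * d.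
Proof. by move=> <-; rewrite mulrA -expr2 sqrr_sign mul1r. Qed.

Lemma det_upper_antitrig : (forall i j : 'I_n, (n <= i + j)%N -> M i j = 0) ->
  \det M = (-1) ^+ rev_perm * \prod_i M i (rev_ord i).
Proof.
move=> M0; apply: det_rev; rewrite -det_rev_cols -det_tr det_trig.
  by apply: eq_bigr => i _; rewrite !mxE.
by apply/is_trig_mxP => i j lt_ij; rewrite !mxE M0 //=; have := ltn_ord i; lia.
Qed.

Lemma det_lower_antitrig : (forall i j : 'I_n, (i + j < n.-1)%N -> M i j = 0) ->
  \det M = (-1) ^+ rev_perm * \prod_i M i (rev_ord i).
Proof.
move=> M0; apply: det_rev; rewrite -det_rev_cols det_trig.
  by apply: eq_bigr => i _; rewrite !mxE.
by apply/is_trig_mxP => i j lt_ij; rewrite !mxE M0 //=; have := ltn_ord j; lia.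
Qed.

End AntiTriangular.

(* The coefficients of the r linear syzygies of the partial derivatives. *)
Definition polar_coef (r a b : nat) : int :=
  if (a + b < r)%N then (b + 2 * a)%N%:Z else a%:Z - 1.

(** * Power series identities behind the polar system *)

Section TruncatedSeries.
Variables (A : comNzRingType) (r : nat).
Implicit Types p q u : {poly A}.

Definition eqtrunc p q := forall n, (n <= r)%N -> p`_n = q`_n.

Lemma eqtrunc_mul u p q : eqtrunc p q -> eqtrunc (u * p) (u * q).
Proof.
by move=> e n le_n; rewrite !coefM; apply: eq_bigr => a _; rewrite e //; lia.
Qed.

(** The derivation t d/dt, which leaves the indices of coefficients unshifted. *)
Definition euler p := 'X * p^`().

Lemma coef_euler p n : (euler p)`_n = p`_n *+ n.
Proof. by rewrite coefXM coef_deriv; case: n => [|n] /=; rewrite ?mulr0n. Qed.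

Lemma eulerM p q : euler (p * q) = euler p * q + p * euler q.
Proof. by rewrite /euler derivM; ring. Qed.

Lemma eqtrunc_euler p q : eqtrunc p q -> eqtrunc (euler p) (euler q).
Proof. by move=> e n le_n; rewrite !coef_euler e. Qed.

Variables (C Y : {poly A}) (kappa : A).
Hypothesis CY : eqtrunc (C * Y) kappa%:P.

Let eulerC : euler kappa%:P = 0.
Proof. by rewrite /euler derivC mulr0. Qed.

(* With C = kappa / Y, this is the equation Y E' + 2 Y' E = 0 for E = C^2. *)
Lemma series_square n : (n <= r)%N ->
  \sum_(a < n.+1) (n - a + 2 * a)%N%:R * (Y`_a * (C ^+ 2)`_(n - a)) = 0.
Proof.
move=> le_n; transitivity ((2%:R * C * euler (C * Y))`_n).
  have -> : 2%:R * C * euler (C * Y) = Y * euler (C ^+ 2) + 2%:R * (euler Y * C ^+ 2).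
    by rewrite expr2 !eulerM; ring.
  rewrite coefD mulr_natl coefMn !coefM -sumrMnl -big_split; apply: eq_bigr => a _ /=.
  by rewrite !coef_euler natrD natrM; ring.
by rewrite (eqtrunc_mul _ (eqtrunc_euler CY)) // eulerC mulr0 coef0.
Qed.

(** The coefficient of t^r in Y' C^2 = C (C Y)' - C' (C Y), the prime denoting t d/dt; to this order
    C Y is constant. *)
Lemma series_weight :
  \sum_(a < r.+1) a%:R * (Y`_a * (C ^+ 2)`_(r - a)) = - kappa * (C`_r *+ r).
Proof.
transitivity ((C * euler (C * Y) - euler C * (C * Y))`_r).
  have -> : C * euler (C * Y) - euler C * (C * Y) = euler Y * C ^+ 2.
    by rewrite expr2 !eulerM; ring.
  by rewrite coefM; apply: eq_bigr => a _ /=; rewrite coef_euler; ring.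
rewrite coefB (eqtrunc_mul _ (eqtrunc_euler CY)) // (eqtrunc_mul _ CY) //.
by rewrite eulerC mulr0 coef0 coefMC coef_euler; ring.
Qed.

Lemma series_degree :
  \sum_(a < r.+1) Y`_a * (C ^+ 2)`_(r - a) = kappa * C`_r.
Proof.
transitivity ((C * (C * Y))`_r); first by rewrite mulrA -expr2 mulrC coefM.
by rewrite (eqtrunc_mul _ CY) // coefMC mulrC.
Qed.

(** P stands for the partial derivatives of f = C_r, and w for y_0^r up to sign. The term in w comes
    from differentiating kappa, which depends on y_0 only. *)
Variables (P : nat -> A) (w : A).
Hypothesis kappaE : kappa = Y`_0 * w.
Hypothesis PE : forall a, (a <= r)%N ->
  kappa * P (r - a)%N = (r.+1)%:R * w * (0%N == a)%:R * C`_r - (C ^+ 2)`_(r - a).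

(** The extra term of [P r] enters at a = 0 with weight -1 and contributes -(r+1) kappa C_r. The
    weights a and -1 on the remaining terms give r kappa C_r and kappa C_r, by [series_weight] and
    [series_degree]. *)
Lemma series_polar_top : kappa * lform (polar_coef r) (fun a => Y`_a) P r = 0.
Proof.
rewrite /lform mulr_sumr.
have termE (a : 'I_r.+1) : kappa * ((polar_coef r a (r - a))%:~R * (Y`_a * P (r - a)%N))
    = - (0%N == a)%:R * ((r.+1)%:R * (kappa * C`_r))
      - (a%:R * (Y`_a * (C ^+ 2)`_(r - a)) - Y`_a * (C ^+ 2)`_(r - a)).
  have le_a : (a <= r)%N by rewrite -ltnS.
  have e := PE le_a.
  have -> : (polar_coef r a (r - a))%:~R = a%:R - 1 :> A.
    by rewrite /polar_coef subnKC // ltnn rmorphB.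
  transitivity ((a%:R - 1) * (Y`_a * (kappa * P (r - a)%N))); first by ring.
  rewrite e; case: eqP => [<-|_] /=; last by ring.
  by rewrite kappaE; ring.
under eq_bigr do rewrite termE.
rewrite sumrB sumrB -mulr_suml series_weight series_degree.
rewrite (_ : \sum_(a < r.+1) - (0%N == a)%:R = - 1 :> A); first by ring.
by rewrite sumrN big_ord_recl big1 ?addr0.
Qed.

Lemma series_polar n : (0 < n < r)%N ->
  kappa * lform (polar_coef r) (fun a => Y`_a) P n = 0.
Proof.
move=> /andP[n0 lt_n]; rewrite /lform mulr_sumr; have e := series_square (ltnW lt_n).
apply/eqP; rewrite -oppr_eq0 -sumrN; apply/eqP; rewrite -[RHS]e; apply: eq_bigr => a _.
have le_a : (a <= n)%N by rewrite -ltnS.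
have := PE (leq_subr (n - a) r); rewrite subKn; last by lia.
rewrite (_ : (0%N == (r - (n - a))%N) = false) ?mulr0 ?mul0r ?sub0r => [eP|]; last by lia.
by rewrite mulrCA [kappa * _]mulrCA eP !mulrN opprK /polar_coef subnKC // lt_n.
Qed.

End TruncatedSeries.

Section CoefficientDerivation.
Variables (A : comNzRingType) (n r : nat) (v : 'I_n).
Local Notation R := {mpoly A[n]}.

Definition coef_mderiv (p : {poly R}) : {poly R} := map_poly (mderiv v) p.

Lemma coef_coef_mderiv p m : (coef_mderiv p)`_m = (p`_m)^`M(v).
Proof. by rewrite coef_map_id0 // mderiv0. Qed.

Lemma coef_mderivM p q : coef_mderiv (p * q) = coef_mderiv p * q + p * coef_mderiv q.
Proof.
apply/polyP => m; rewrite coefD coef_coef_mderiv !coefM (raddf_sum (mderiv v)) /=.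
by rewrite -big_split; apply: eq_bigr => a _; rewrite mderivM !coef_coef_mderiv.
Qed.

Lemma coef_mderivC a : coef_mderiv a%:P = (a^`M(v))%:P.
Proof.
by rewrite /coef_mderiv map_polyC.
Qed.

Lemma mderiv_exp (p : R) m : (p ^+ m.+1)^`M(v) = (p ^+ m * p^`M(v)) *+ m.+1.
Proof.
elim: m => [|m IH]; first by rewrite mul1r.
by rewrite exprS mderivM IH [p ^+ m.+1]exprS; ring.
Qed.

Lemma eqtrunc_mderiv p q : eqtrunc r p q -> eqtrunc r (coef_mderiv p) (coef_mderiv q).
Proof. by move=> e m le_m; rewrite !coef_coef_mderiv e. Qed.

End CoefficientDerivation.

(** * Partial derivatives of the sub-Hankel determinant *)

Section SubHankel.
Variables (k : fieldType) (r : nat).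
Local Notation R := {mpoly k[r.+1]}.
Local Notation f := (sub_hankel_det k r).
Local Notation y := (@var_down k r).

(** The sub-Hankel matrix bordered to size r + 1 becomes anti-triangular with y_0 on its
    antidiagonal. The last row C of its adjugate ends in the cofactor f. *)
Let He : 'M[R]_r.+1 :=
  \matrix_(p, q) if (p + q <= r)%N then 'X_(inord (p + q)) else 0.
Let C (q : nat) : R := (\adj He) ord_max (inord q).
Let eps : R := ((-1) ^+ (perm (@rev_ord_inj r.+1)))%:MP.

Let He_y (p q : 'I_r.+1) : He p q = if (p + q <= r)%N then y (r - (p + q)) else 0.
Proof. by rewrite mxE; case: leqP => // le_pq; rewrite /var_down subKn. Qed.

Let det_He : \det He = eps * y 0 ^+ r.+1.
Proof.
rewrite det_upper_antitrig => [|p q lt_pq]; last by rewrite He_y leqNgt lt_pq.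
rewrite (eq_bigr (fun=> y 0)) => [|p _].
  by rewrite prodr_const card_ord /eps rmorph_sign.
by rewrite He_y /= subSS subnKC -1?ltnS // leqnn subnn.
Qed.

Let C_r : C r = f.
Proof.
rewrite /C (_ : inord r = ord_max); last by apply: val_inj; rewrite /= inordK.
have e : row' ord_max (col' ord_max He) = sub_hankel k r.
  apply/matrixP => p q; rewrite [LHS]mxE [LHS]mxE [LHS]mxE [RHS]mxE.
  by rewrite !lift_max.
by rewrite mxE /cofactor e -signr_odd oddD addbb mul1r.
Qed.

Let Cp : {poly R} := \poly_(q < r.+1) C q.
Let Yp : {poly R} := \poly_(a < r.+1) y a.
Let kappa : R := eps * y 0 ^+ r.+1.

Let coef_C n : (n <= r)%N -> Cp`_n = C n.
Proof. by move=> le_n; rewrite coef_poly ltnS le_n. Qed.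
Let coef_Y n : (n <= r)%N -> Yp`_n = y n.
Proof. by move=> le_n; rewrite coef_poly ltnS le_n. Qed.

(** The last row of the adjugate identity, with columns in reverse order: C is kappa / Y up to order
    r. *)
Let CY : eqtrunc r (Cp * Yp) kappa%:P.
Proof.
move=> n le_n; rewrite coefM coefC.
have /matrixP/(_ ord_max (inord (r - n))) := mul_adj_mx He.
rewrite !mxE det_He -/kappa => e.
transitivity (kappa *+ (ord_max == inord (r - n) :> 'I_r.+1)); last first.
  rewrite -val_eqE /= inordK; last by lia.
  have -> : (r == r - n)%N = (n == 0)%N by apply/eqP/eqP; lia.
  by case: (n == 0)%N; rewrite ?mulr0n.
rewrite -[RHS]e (big_ord_widen r.+1 (fun q => Cp`_q * Yp`_(n - q))) //.
rewrite big_mkcond; apply: eq_bigr => q _ /=.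
rewrite He_y inordK; last by lia.
rewrite ltnS; case: leqP => [le_q|lt_q].
  rewrite ifT; last by lia.
  rewrite coef_C ?coef_Y; [|by lia|by lia].
  by rewrite /C inord_val; congr (_ * y _); lia.
by rewrite ifF ?mulr0 //; lia.
Qed.

Let v (j : nat) : 'I_r.+1 := inord (r - j).

Let deriv_y j a : (j <= r)%N -> (a <= r)%N -> (y a)^`M(v j) = (a == j)%:R.
Proof.
move=> le_j le_a; rewrite mderivX mnm1E.
have -> : (inord (r - a) == v j) = (a == j).
  by rewrite /v -val_eqE /= !inordK; [|lia|lia]; apply/eqP/eqP; lia.
case: eqP => [->|_]; last by rewrite scale0r.
by rewrite scale1r -[X in (X - _)%MM]add0m addmK mpolyX0.
Qed.

Let derivC_Y j : (j <= r)%N -> eqtrunc r (coef_mderiv (v j) Yp) 'X^j.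
Proof.
move=> le_j n le_n; rewrite coef_coef_mderiv coef_Y // deriv_y // coefXn.
by [].
Qed.

(** Differentiating C Y = kappa and multiplying by C replaces C Y by kappa; since the derivative of
    Y in y_j is t^j, the coefficient of t^r gives the formula. *)
Let partial_f j : (j <= r)%N ->
  kappa * f^`M(v j) = kappa^`M(v j) * f - (Cp ^+ 2)`_(r - j).
Proof.
move=> le_j.
have e1 := eqtrunc_mul Cp (eqtrunc_mderiv (v j) CY) (leqnn r).
have e2 := eqtrunc_mul (coef_mderiv (v j) Cp) CY (leqnn r).
have e3 := eqtrunc_mul (Cp ^+ 2) (derivC_Y le_j) (leqnn r).
have eCp : Cp`_r = f by rewrite coef_C.
rewrite coefMXn ltnNge le_j /= in e3; rewrite -e3.
rewrite coef_mderivM coef_mderivC coefMC eCp in e1.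
rewrite coefMC coef_coef_mderiv eCp in e2.
rewrite mulrC -e2 [_ * f]mulrC -e1 -coefB.
apply: (congr1 (fun p : {poly R} => p`_r)); ring.
Qed.

Let dkappa j : (j <= r)%N ->
  kappa^`M(v j) = (r.+1)%:R * (eps * y 0 ^+ r) * (0 == j)%:R.
Proof.
move=> le_j; rewrite -[LHS]/(mderiv (v j) (eps * y 0 ^+ r.+1)).
rewrite [LHS]mderiv_mulC mderiv_exp deriv_y //.
by rewrite -/eps; move: eps (y 0) (_ == _)%:R => a b d; ring.
Qed.

Definition hankel_partial (b : nat) : R := f^`M(inord b).
Local Notation partial := hankel_partial.

Let partialE a : (a <= r)%N ->
  kappa * partial (r - a) = (r.+1)%:R * (eps * y 0 ^+ r) * (0%N == a)%:R * Cp`_r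
    - (Cp ^+ 2)`_(r - a).
Proof. by move=> le_a; rewrite coef_C // C_r -dkappa //; apply: partial_f. Qed.

Let kappa_neq0 : kappa != 0.
Proof.
by rewrite mulf_neq0 ?expf_neq0 // ?mpolyC_eq0 ?signr_eq0 // (mpolyX_neq0 k).
Qed.

Let kappaE : kappa = Yp`_0 * (eps * y 0 ^+ r).
Proof. by rewrite coef_Y // mulrCA -exprS. Qed.

Lemma lform_polar n : (0 < n <= r)%N -> lform (polar_coef r) y partial n = 0.
Proof.
move=> /andP[n0 le_n]; apply: (mulfI kappa_neq0); rewrite mulr0.
rewrite (@eq_lform _ _ y (fun a => Yp`_a) partial partial) => [|a le_a|//]; last first.
  by rewrite coef_Y //; lia.
move: le_n; rewrite leq_eqVlt => /predU1P[->|lt_n].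
  exact: (series_polar_top CY kappaE partialE).
have n_r : (0 < n < r)%N by rewrite n0.
exact: (series_polar CY partialE n_r).
Qed.

Hypothesis r_gt0 : (0 < r)%N.

Lemma polar_0 : exists u : k, u != 0 /\ partial 0 = u *: y 0 ^+ r.-1.
Proof.
(* From C_0 = eps y_0^r and kappa P_0 = - C_0^2, where kappa = eps y_0^(r+1) and eps is this
   permutation sign. *)
exists (- (-1) ^+ (perm (@rev_ord_inj r.+1))); split; first by rewrite oppr_eq0 signr_eq0.
rewrite -mul_mpolyC mpolyCN -/eps.
have C0 : Cp`_0 = eps * y 0 ^+ r.
  apply: (mulIf (mpolyX_neq0 k (inord (r - 0)))); rewrite -mulrA -exprSr.
  by have := CY (leq0n r); rewrite coefM big_ord1 coefC coef_Y.
have := partialE (leqnn r); rewrite subnn (_ : (0%N == r) = false); last by lia.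
rewrite mulr0 mul0r sub0r expr2 coefM big_ord1 C0 => e.
have yr : y 0 ^+ r = y 0 ^+ r.-1 * y 0 by rewrite -exprSr prednK.
apply: (mulfI kappa_neq0); rewrite e /kappa exprS yr.
by move: eps (y 0 ^+ r.-1) (y 0) => a b d; ring.
Qed.

End SubHankel.

(** * Hessian, linear syzygies and polar map *)

Lemma char0_int (k : fieldType) (z : int) :
  [pchar k] =i pred0 -> z != 0 -> z%:~R != 0 :> k.
Proof.
move=> /pcharf0P hk; case: z => n.
  by rewrite eqz_nat -lt0n => n0; rewrite -pmulrn hk -lt0n.
by rewrite NegzE => _; rewrite mulrNz oppr_eq0 -pmulrn hk.
Qed.

Lemma mpoly_int_neq0 (k : fieldType) n (z : int) :
  z%:~R != 0 :> k -> z%:~R != 0 :> {mpoly k[n]}.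
Proof. by move=> z0; rewrite -mpolyC_int mpolyC_eq0. Qed.

Lemma mderiv_homog (k : fieldType) n (p : {mpoly k[n]}) d j :
  p \is d.+1.-homog -> p^`M(j) \is d.-homog.
Proof.
move=> hp; apply/dhomogP => m; rewrite mcoeff_msupp mcoeff_deriv => nz.
have : (m + U_(j))%MM \in msupp p.
  by rewrite mcoeff_msupp; apply: contraNneq nz => ->; rewrite mul0rn.
by move/(dhomog_mf hp) => /=; rewrite mdegD mdeg1 addn1 => -[].
Qed.

Section PolarSystem.
Variables (k : fieldType) (r : nat).
Hypothesis hk : [pchar k] =i pred0.
Hypothesis r2 : (2 <= r)%N.
Local Notation R := {mpoly k[r.+1]}.
Local Notation f := (sub_hankel_det k r).
Local Notation y := (@var_down k r).
Local Notation P := (hankel_partial k r).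

Lemma polar_coef0n n : (0 < n)%N -> polar_coef r 0 n != 0.
Proof.
move=> n0; rewrite /polar_coef; case: ltnP => lt_n; first by rewrite eqz_nat; lia.
by rewrite sub0r oppr_eq0.
Qed.

(** Here r >= 2 enters: for n = r the weight is r - 1. *)
Lemma polar_coefn0 n : (0 < n)%N -> polar_coef r n 0 != 0.
Proof.
move=> n0; rewrite /polar_coef; case: ltnP => lt_n; first by rewrite eqz_nat; lia.
by rewrite subr_eq0 eqz_nat; lia.
Qed.

Let c0 n : (0 < n)%N -> (polar_coef r 0 n)%:~R != 0 :> k.
Proof. by move=> n0; apply/char0_int/polar_coef0n. Qed.

Let c1 n : (0 < n)%N -> (polar_coef r n 0)%:~R != 0 :> k.
Proof. by move=> n0; apply/char0_int/polar_coefn0. Qed.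

Lemma y0E : y 0 = 'X_ord_max.
Proof.
by rewrite /var_down subn0; congr 'X_ _; apply: val_inj; rewrite /= inordK.
Qed.

(** The r linear syzygies, completed by the row (1, 0, ..., 0) to a square triangular matrix. *)
Let syz_mx : 'M[R]_r.+1 :=
  \matrix_(n, j) if n == ord0 then (j == ord0)%:R else lrow (polar_coef r) y n j.
Let H : 'M[R]_r.+1 := \matrix_(i, j) f^`M(i)^`M(j).

Let syz_mxE (n j : 'I_r.+1) : (0 < n)%N -> syz_mx n j = lrow (polar_coef r) y n j.
Proof.
move=> n0; rewrite mxE (_ : (n == ord0) = false) //.
by apply/eqP => e; rewrite e in n0.
Qed.

Let det_syz : exists w : k, w != 0 /\ \det syz_mx = w *: y 0 ^+ r.
Proof.
exists (\prod_(n < r) (polar_coef r 0 n.+1)%:~R); split.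
  by apply/prodf_neq0 => n _; apply: c0.
rewrite det_trig; last first.
  apply/is_trig_mxP => n j lt_nj; rewrite mxE /lrow leqNgt lt_nj /=.
  case: eqP => // n0; case: eqP => // j0.
  by rewrite n0 j0 ltnn in lt_nj.
rewrite big_ord_recl mxE eqxx mul1r -mul_mpolyC rmorph_prod /=.
rewrite -[X in _ ^+ X](card_ord r) -prodr_const -big_split; apply: eq_bigr => n _.
by rewrite syz_mxE // /lrow leqnn subnn mpolyC_int lift0.
Qed.

Let P_homog b : P b \is r.-1.-homog.
Proof.
apply: mderiv_homog; rewrite prednK; last by lia.
apply: rpred_sum => s _; rewrite -signr_odd mulr_sign.
have : \prod_i sub_hankel k r i (s i) \is (\sum_(i < r) 1)%N.-homog.
  elim/big_ind2: _ => [|p d q e hp hq|i _]; [exact: dhomog1 | exact: dhomogM |].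
  by rewrite mxE; case: ifP => _; rewrite ?dhomog0 // dhomogX /= mdeg1.
by rewrite sum1_card card_ord => hp; case: ifP => _; rewrite ?rpredN.
Qed.

Let syz_P (n : 'I_r.+1) : (0 < n)%N -> \sum_j syz_mx n j * P j = 0.
Proof.
move=> n0; have le_n : (n <= r)%N by rewrite -ltnS.
rewrite -[RHS](@lform_polar k r n) ?n0 // (lform_lrow _ _ _ le_n).
by apply: eq_bigr => j _; rewrite syz_mxE.
Qed.

Let lrow_deriv n j a : (j <= n <= r)%N -> (a <= r)%N ->
  (lrow (polar_coef r) y n j)^`M(inord (r - a)) =
    ((polar_coef r a (n - a))%:~R * ((n - j)%N == a)%:R)%:MP.
Proof.
move=> /andP[le_j le_n] le_a; rewrite /lrow le_j -mpolyC_int mderiv_mulC mderivX mnm1E.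
have -> : (inord (r - (n - j)) == inord (r - a) :> 'I_r.+1) = ((n - j)%N == a).
  by rewrite -val_eqE /= !inordK; [|lia|lia]; apply/eqP/eqP; lia.
case: eqP => [<-|_]; last by rewrite scale0r !mulr0 mpolyC0.
by rewrite subKn // scale1r -[X in (X - _)%MM]add0m addmK mpolyX0 !mulr1.
Qed.

(** Differentiating the n-th syzygy in x_i moves the derivative from the partials to the
    coefficients. The variable x_i = y_(r-i) occurs in at most one of these, that of P_(n-(r-i)), so
    the product is anti-triangular. *)
Let syz_H (n i : 'I_r.+1) : (0 < n)%N ->
  (syz_mx *m H) n i = if (r <= n + i)%N
    then - (polar_coef r (r - i) (n - (r - i)))%:~R * P (n - (r - i)) else 0.
Proof.
move=> n0; have le_n : (n <= r)%N by rewrite -ltnS.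
have le_i : (i <= r)%N by rewrite -ltnS.
have := congr1 (mderiv i) (syz_P n0); rewrite mderiv0 (raddf_sum (mderiv i)) /=.
under eq_bigr do rewrite mderivM.
rewrite big_split /= => /eqP; rewrite addrC addr_eq0 => /eqP e.
have -> : (syz_mx *m H) n i = \sum_j syz_mx n j * (P j)^`M(i).
  rewrite mxE; apply: eq_bigr => j _; rewrite [H _ _]mxE.
  by rewrite /hankel_partial inord_val.
rewrite {}e -sumrN.
have termE (j : 'I_r.+1) : - ((syz_mx n j)^`M(i) * P j) =
    if (j <= n)%N && ((n - j)%N == (r - i)%N)
    then - (polar_coef r (r - i) (n - (r - i)))%:~R * P j else 0.
  rewrite syz_mxE //.
  case: leqP => [le_j|lt_j] /=; last by rewrite /lrow leqNgt lt_j mderiv0 mul0r oppr0.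
  rewrite -[i]inord_val -{1}(subKn le_i) lrow_deriv ?le_j ?leq_subr // inord_val.
  case: eqP => _; last by rewrite mulr0 mpolyC0 mul0r oppr0.
  by rewrite mulr1 mpolyC_int mulNr.
under eq_bigr do rewrite termE.
rewrite -big_mkcond /=; case: leqP => [le_r|lt_r].
  have lt_n : (n - (r - i) < r.+1)%N by lia.
  rewrite (bigD1 (Ordinal lt_n)) /=; last by apply/andP; split; [lia | apply/eqP; lia].
  rewrite big1 ?addr0 // => j /andP[/andP[le_j /eqP e] ne_j].
  by case/eqP: ne_j; apply: val_inj => /=; lia.
by rewrite big_pred0 // => j; apply/negP => /andP[le_j /eqP e]; lia.
Qed.

Let syz_H0 i : exists2 u : k, u != 0 &
  (syz_mx *m H) ord0 i = (i == ord_max)%:R * (u *: y 0 ^+ (r - 2)).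
Proof.
have [u [u0 e]] := @polar_0 k r ltac:(lia).
exists (u *+ r.-1).
  rewrite -mulr_natr mulf_neq0 //; move/pcharf0P: hk => ->.
  by rewrite -lt0n; lia.
have -> : (syz_mx *m H) ord0 i = (P 0)^`M(i).
  rewrite mxE big_ord_recl big1 => [|j _]; last first.
    by rewrite [syz_mx _ _]mxE eqxx /= mul0r.
  rewrite [syz_mx _ _]mxE eqxx /= mul1r addr0 mxE /hankel_partial.
  by congr (_^`M(_)^`M(_)); apply: val_inj; rewrite /= inordK.
rewrite e mderivZ; have -> : r.-1 = (r - 2).+1 by lia.
rewrite mderiv_exp {2}y0E mderivX mnm1E eq_sym; case: eqP => [->|_]; last first.
  by rewrite scale0r mulr0 mul0rn scaler0 mul0r.
rewrite scale1r -[X in (X - _)%MM]add0m addmK mpolyX0 mulr1 mul1r.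
by rewrite -scalerMnr scalerMnl.
Qed.

(** On the antidiagonal of [syz_mx *m H], row 0 has a multiple of y_0^(r-2) and each of the r other
    rows a multiple of P_0, that is of y_0^(r-1). Dividing by det [syz_mx], a multiple of y_0^r,
    leaves the exponent (r-2) + r(r-1) - r = (r+1)(r-2). *)
Lemma hessian_hankel : exists w : k,
  w != 0 /\ hessian f = w *: 'X_ord_max ^+ ((r + 1) * (r - 2)).
Proof.
have [w [w0 ew]] := det_syz; have [u u0 eu] := syz_H0 ord_max.
have [v [v0 ev]] := @polar_0 k r ltac:(lia).
have anti : forall n i : 'I_r.+1, (n + i < r.+1.-1)%N -> (syz_mx *m H) n i = 0.
  move=> n i lt_r; have [n0|n0] := posnP n; last by rewrite syz_H // leqNgt lt_r.
  have -> : n = ord0 by apply: val_inj.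
  have [u' _ ->] := syz_H0 i; rewrite (_ : (i == _) = false) ?mul0r //.
  by apply/eqP => ei; move: lt_r; rewrite ei n0 /= ltnn.
have := det_mulmx syz_mx H; rewrite det_lower_antitrig // ew.
set sg := _ ^+ _; rewrite big_ord_recl.
have -> : rev_ord ord0 = ord_max :> 'I_r.+1 by apply: val_inj; rewrite /= subn1.
rewrite eu eqxx mul1r (eq_bigr (fun n : 'I_r =>
  (- (polar_coef r n.+1 0)%:~R * v)%:MP * y 0 ^+ r.-1)); last first.
  move=> n _; rewrite syz_H // lift0.
  have lt_n := ltn_ord n.
  have -> : (r - rev_ord (lift ord0 n) = n.+1)%N.
    by rewrite /= /bump /= add1n subSS; lia.
  rewrite ifT; last by rewrite /= /bump /= add1n; lia.
  by rewrite subnn ev -mul_mpolyC mulrA mpolyCM mpolyCN mpolyC_int.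
rewrite big_split /= -rmorph_prod prodr_const card_ord -exprM.
set d := \prod_(n < r) _ => e.
have d0 : d != 0.
  by apply/prodf_neq0 => n _; rewrite mulf_neq0 // oppr_eq0 c1.
exists (w^-1 * ((-1) ^+ perm (@rev_ord_inj r.+1) * (u * d))); split.
  by rewrite !mulf_neq0 ?invr_eq0 ?signr_eq0.
have yr0 : y 0 ^+ r != 0 by rewrite expf_neq0 // (mpolyX_neq0 k).
have w0' : w%:MP != 0 :> R by rewrite mpolyC_eq0.
apply: (mulfI yr0); apply: (mulfI w0').
have -> : w%:MP * (y 0 ^+ r * hessian f) = w *: y 0 ^+ r * \det H.
  by rewrite mulrA mul_mpolyC.
rewrite -e -y0E -!mul_mpolyC !mpolyCM /sg -(rmorph_sign (@mpolyC r.+1 k)) /=.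
have ww : w%:MP * w^-1%:MP = 1 :> R by rewrite -mpolyCM mulfV.
have ey : y 0 ^+ (r - 2) * y 0 ^+ (r.-1 * r) = y 0 ^+ r * y 0 ^+ ((r + 1) * (r - 2)).
  by rewrite -!exprD; congr (_ ^+ _); move: r2; case: (r) => [|[|q]] // _; nia.
(* Stated for arbitrary ring elements so that the powers of y_0 are opaque to [ring]. *)
have balance (T : comNzRingType) (S u1 d1 w1 w' A B D E : T) : w1 * w' = 1 ->
    A * B = D * E -> S * (u1 * A * (d1 * B)) = w1 * (D * (w' * (S * (u1 * d1)) * E)).
  move=> ww1 AB; transitivity ((w1 * w') * S * u1 * d1 * (D * E)); last by ring.
  by rewrite ww1 -AB; ring.
exact: balance.
Qed.

(** Differentiating a linear relation with constant coefficients gives a vector in the kernel of the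
    Hessian matrix, whose determinant is nonzero. *)
Lemma partials_independent (a : 'I_r.+1 -> k) :
  \sum_j a j *: tnth (polar_map f) j = 0 -> forall j, a j = 0.
Proof.
move=> a_0; have [w [w0 eH]] := hessian_hankel.
have H0 : \det H != 0.
  by rewrite -[\det H]/(hessian f) eH -mul_mpolyC mulf_neq0 ?mpolyC_eq0 ?expf_neq0 //
    (mpolyX_neq0 k).
have vH : (\row_j (a j)%:MP) *m H = 0.
  apply/rowP => i; rewrite !mxE; have := congr1 (mderiv i) a_0.
  rewrite mderiv0 (raddf_sum (mderiv i)) => e; rewrite -[RHS]e; apply: eq_bigr => j _.
  by rewrite !mxE tnth_mktuple mul_mpolyC /= mderivZ.
move=> j; have := congr1 (mulmx^~ (\adj H)) vH.
rewrite mul0mx -mulmxA mul_mx_adj mul_mx_scalar => /rowP/(_ j); rewrite !mxE => /eqP.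
by rewrite mulf_eq0 (negPf H0) mpolyC_eq0 => /eqP.
Qed.

Lemma dhomog1_eq0 (p : {mpoly k[r.+1]}) : p \is 1.-homog -> (forall t, p@_U_(t) = 0) -> p = 0.
Proof.
move=> hp p0; apply/mpolyP => m; rewrite mcoeff0.
have [/mdeg1P[t /eqP->]|m1] := boolP (mdeg m == 1%N); first exact: p0.
exact: dhomog_nemf_coeff hp m1.
Qed.

Lemma coef_mul_homog (p q : {mpoly k[r.+1]}) d t : q \is d.-homog -> (0 < d)%N ->
  (p * q)@_U_(t) = p@_0%MM * q@_U_(t).
Proof.
move=> hq d0.
have deriv0 g : g@_U_(t) = g^`M(t)@_0%MM :> k by rewrite mcoeff_deriv add0m mnm0E.
have q0 : q@_0%MM = 0 by apply: (dhomog_nemf_coeff hq); rewrite /= mdeg0 eq_sym -lt0n.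
rewrite !deriv0 mderivM mcoeffD !(rmorphM (mcoeff 0%MM)) /= q0 mulr0 add0r.
by [].
Qed.

Local Notation K := (map_mx (@FracField.tofrac R)).

(** The rank is at most r because [phi1] annihilates the nonzero gradient. It is at least r because
    the r independent linear syzygies are combinations of the rows of [phi1]. *)
Lemma polar_linear_part : linear_part_has_max_rank (tnth (polar_map f)).
Proof.
split; first exact: partials_independent.
move=> l m phi1 e phi2 [phi1_homog e2 phi2_homog pres].
set g := tnth (polar_map f) in pres.
have gE j : g j = P j by rewrite /g tnth_mktuple /hankel_partial inord_val.
have [v [v0 ev]] := @polar_0 k r ltac:(lia).
have g0 : g ord0 != 0.
  by rewrite gE ev -mul_mpolyC mulf_neq0 ?mpolyC_eq0 ?expf_neq0 // (mpolyX_neq0 k).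
apply/eqP; rewrite eqn_leq /=; apply/andP; split.
  have g_phi1 : phi1 *m \col_j g j = 0.
    apply/row_matrixP => c; rewrite row_mul row0; apply/pres.
    by exists (delta_mx 0 c), 0; rewrite mul0mx addr0 rowE.
  have := congr1 K g_phi1; rewrite map_mxM map_mx0 => /mulmx0_rank_max.
  have : (0 < \rank (K (\col_j g j)))%N.
    rewrite lt0n mxrank_eq0; apply/eqP => /matrixP/(_ ord0 ord0); rewrite !mxE => /eqP.
    by rewrite tofrac_eq0 (negPf g0).
  by move: (\rank (K (\col_j g j))) (\rank (K phi1)) => q p; lia.
pose syz' : 'M[R]_(r, r.+1) := \matrix_(n, j) syz_mx (lift ord0 n) j.
have syz_free : row_free (K syz').
  apply: inj_row_free => w w_syz.
  pose w1 : 'rV_r.+1 := \row_n (if unlift ord0 n is Some n' then w 0 n' else 0).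
  have w1_syz : w1 *m K syz_mx = 0.
    rewrite -[RHS]w_syz; apply/rowP => j; rewrite mxE big_ord_recl mxE unlift_none mul0r add0r.
    by rewrite mxE; apply: eq_bigr => n _; rewrite !mxE liftK.
  have : K syz_mx \in unitmx.
    rewrite unitmxE det_map_mx unitfE tofrac_eq0; have [u [u0 ->]] := det_syz.
    by rewrite -mul_mpolyC mulf_neq0 ?mpolyC_eq0 ?expf_neq0 // (mpolyX_neq0 k).
  move=> /mulmxK/(_ w1); rewrite w1_syz mul0mx => w1_0.
  by apply/rowP => n; move/rowP: w1_0 => /(_ (lift ord0 n)); rewrite !mxE liftK => <-.
have lrow_homog n j : lrow (polar_coef r) y n j \is 1.-homog.
  rewrite /lrow; case: ifP => _; last exact: dhomog0.
  by rewrite -mpolyC_int mul_mpolyC dhomogZ // dhomogX /= mdeg1.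
have /choice[a ea] (n : 'I_r) : exists a : 'rV[R]_l, row n syz' = a *m phi1.
  have /pres[a [b eab]] : row n syz' *m (\col_j g j) = 0.
    apply/matrixP => i0 j0; rewrite mxE [RHS]mxE -[RHS](@syz_P (lift ord0 n)) //.
    by apply: eq_bigr => j _; rewrite !mxE gE.
  (* The syzygy and [phi1] have linear entries while [phi2] starts in degree 2, so in degree one
     only the constant terms of [a] survive. *)
  exists (map_mx (fun p : R => (p@_0%MM)%:MP) a); apply/rowP => j.
  apply/eqP; rewrite -subr_eq0; apply/eqP/dhomog1_eq0 => [|t].
    apply: rpredB; first by rewrite [row _ _ _ _]mxE [syz' _ _]mxE syz_mxE.
    rewrite mxE; apply: rpred_sum => c _; rewrite [map_mx _ _ _ _]mxE mul_mpolyC.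
    exact: dhomogZ.
  apply/eqP; rewrite mcoeffB subr_eq0; apply/eqP.
  have -> : row n syz' 0 j = (a *m phi1) 0 j + (b *m phi2) 0 j by rewrite eab mxE.
  rewrite mcoeffD [X in _ + X](_ : _ = 0) ?addr0.
    rewrite [(a *m _) _ _]mxE [(_ *m _) _ _]mxE !(raddf_sum (mcoeff U_(t))).
    apply: eq_bigr => c _ /=.
    by rewrite (coef_mul_homog _ _ (phi1_homog c j)) // mxE mul_mpolyC mcoeffZ.
  rewrite mxE (raddf_sum (mcoeff U_(t))) big1 // => c _ /=.
  rewrite (coef_mul_homog _ _ (phi2_homog c j)); last by have := e2 c; lia.
  rewrite (dhomog_nemf_coeff (phi2_homog c j)) ?mulr0 //= mdeg1 eq_sym.
  by apply/eqP => e1; have := e2 c; rewrite e1.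
have syzE : syz' = (\matrix_n a n) *m phi1.
  by apply/row_matrixP => n; rewrite ea row_mul rowK.
have /eqP rank_syz := syz_free.
by apply: leq_trans (eq_leq (esym rank_syz)) _; rewrite syzE map_mxM; apply: mxrankM_maxr.
Qed.

(** The inverse map is the generic solution, of degree r, of the system with transposed weights. *)
Lemma hankel_homaloidal : homaloidal f.
Proof.
pose cT a b := polar_coef r b a.
pose G : r.+1.-tuple R := [tuple asol cT (@var_up k r) r (r - j) | j < r.+1].
have GE a : (a <= r)%N -> map_down G a = asol cT (@var_up k r) r a.
  by move=> le_a; rewrite /map_down tnth_mktuple inordK ?subKn // ltnS leq_subr.
have FE b : map_up (polar_map f) b = P b by rewrite /map_up tnth_mktuple.
have [u [u0 eu]] := @polar_0 k r ltac:(lia).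
have P0 : P 0 != 0.
  by rewrite eu -mul_mpolyC mulf_neq0 ?mpolyC_eq0 ?expf_neq0 // (mpolyX_neq0 k).
have G0 : map_down G 0 = 1 *: @var_up k r 0 ^+ r by rewrite GE // asol0 scale1r.
exists r.-1, r, G; split.
- split=> [j|]; first by rewrite tnth_mktuple -[j]inord_val; apply: P_homog.
  by exists (inord 0); rewrite -/(map_up _ 0) FE.
- split=> [j|].
    rewrite tnth_mktuple; apply: asol_homog; last exact: leq_subr.
    by move=> a; rewrite dhomogX /= mdeg1.
  exists (inord (r - 0)); rewrite -/(map_down G 0) G0 scale1r expf_neq0 //.
  exact: (mpolyX_neq0 k).
apply: (inverse_maps_lform (c := polar_coef r) _ _ u0 (oner_neq0 k) _ G0).
- by move=> n /andP[n0 _]; apply/mpoly_int_neq0/c0.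
- by move=> n /andP[n0 _]; apply/mpoly_int_neq0/c1.
- by rewrite FE eu.
- move=> n le_n; rewrite -[RHS](lform_polar k le_n). by apply: eq_lform.
move=> n le_n; rewrite lformC -[RHS](@lform_asol k r.+1 cT (@var_up k r) c1 r n le_n).
by apply: eq_lform => // a le_a; rewrite GE //; lia.
Qed.

End PolarSystem.

(** * The maps defined by the first partial derivatives *)

Section PartialMaps.
Variables (k : fieldType) (r i : nat).
Hypothesis hk : [pchar k] =i pred0.
Hypothesis i_r : (1 <= i <= r - 1)%N.
Local Notation R := {mpoly k[i.+1]}.
Local Notation f := (sub_hankel_det k r).

(* For c(a, b) = b + 2 a the system reads Y A' = -2 Y' A, with solution A = Y^(-2) up to a
   factor; exchanging the roles of a and b gives Z B' = - Z' B / 2, that is B = Z^(-1/2). *)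
Let c (a b : nat) : int := (b + 2 * a)%N%:Z.
Let cT (a b : nat) : int := c b a.

Let c_neq0 a b : (0 < a + b)%N -> (c a b)%:~R != 0 :> k.
Proof. by move=> ab; apply: char0_int => //; rewrite eqz_nat; lia. Qed.

Let cT_neq0 a b : (0 < a + b)%N -> (cT a b)%:~R != 0 :> k.
Proof. by rewrite addnC; apply: c_neq0. Qed.

Let i_gt0 : (0 < i)%N. Proof. by case/andP: i_r. Qed.

Let s_down (a : nat) : 'I_i.+1 := inord (i - a).
Let rk_down (v : 'I_i.+1) : nat := (i - v)%N.
Let s_up (a : nat) : 'I_i.+1 := inord a.
Let rk_up (v : 'I_i.+1) : nat := v.

Let s_downK a : (a <= i)%N -> rk_down (s_down a) = a.
Proof. by move=> le_a; rewrite /rk_down inordK ?subKn // ltnS leq_subr. Qed.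
Let rk_downK v : s_down (rk_down v) = v.
Proof. by rewrite /s_down subKn ?inord_val // -ltnS. Qed.
Let s_upK a : (a <= i)%N -> rk_up (s_up a) = a.
Proof. by move=> le_a; rewrite /rk_up inordK. Qed.
Let rk_upK v : s_up (rk_up v) = v. Proof. exact: inord_val. Qed.

Let F : i.+1.-tuple R := [tuple Fsol k s_down c j | j < i.+1].
Let G : i.+1.-tuple R := [tuple Fsol k s_up cT (i - j) | j < i.+1].

Let F_up b : (b <= i)%N -> map_up F b = Fsol k s_down c b.
Proof. by move=> le_b; rewrite /map_up tnth_mktuple inordK. Qed.

Let G_down a : (a <= i)%N -> map_down G a = Fsol k s_up cT a.
Proof. by move=> le_a; rewrite /map_down tnth_mktuple inordK ?subKn // ltnS leq_subr. Qed.

Let F0 : map_up F 0 = 1 *: var_down k i 0 ^+ i.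
Proof. by rewrite F_up // Fsol0 scale1r. Qed.

Let G0 : map_down G 0 = 1 *: var_up k i 0 ^+ i.
Proof. by rewrite G_down // Fsol0 scale1r. Qed.

Let FG_inverse : inverse_maps F G.
Proof.
apply: (inverse_maps_lform (c := c) _ _ (oner_neq0 k) (oner_neq0 k) F0 G0).
- by move=> n /andP[n0 _]; apply/mpoly_int_neq0/c_neq0.
- by move=> n /andP[n0 _]; apply/mpoly_int_neq0/c_neq0; rewrite addn0.
- move=> n le_n; rewrite -[RHS](@lform_Fsol k i s_down c c_neq0 n le_n).
  by apply: eq_lform => // b le_b; apply: F_up; lia.
move=> n le_n; rewrite lformC -[RHS](@lform_Fsol k i s_up cT cT_neq0 n le_n).
by apply: eq_lform => // a le_a; apply: G_down; lia.
Qed.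

Let idealF : ideal_gen (tnth F) = ideal_gen (fun b : 'I_i.+1 => Fsol k s_down c b).
Proof. by congr ideal_gen; apply/funext => j; rewrite tnth_mktuple. Qed.

Let idealG : ideal_gen (tnth G) = ideal_gen (fun b : 'I_i.+1 => Fsol k s_up cT b).
Proof.
apply: ideal_gen_eq => j; first rewrite tnth_mktuple.
  exact: (ideal_gen_gen (fun b : 'I_i.+1 => Fsol k s_up cT b) (rev_ord j)).
have := ideal_gen_gen (tnth G) (rev_ord j).
by rewrite tnth_mktuple /= subSS subKn // -ltnS.
Qed.

Section CommonFactor.
Variables (s : nat -> 'I_i.+1) (rk : 'I_i.+1 -> nat) (e : nat -> nat -> int).
Hypothesis sK : forall a, (a <= i)%N -> rk (s a) = a.
Hypothesis rkK : forall v, s (rk v) = v.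
Hypothesis e_neq0 : forall a b, (0 < a + b)%N -> (e a b)%:~R != 0 :> k.

(** From D F_0 = E u and D F_i = E v follows F_i u = F_0 v, so u is a multiple of F_0 = y_0^i, and
    F_0 cancels. D = 1 gives the absence of common factors, general D the greatest common
    divisor. *)
Lemma divides_Fsol (D E : R) : D != 0 ->
  divides E (D * Fsol k s e 0) -> divides E (D * Fsol k s e i) -> divides E D.
Proof.
move=> D0 [u eu] [v ev].
have E0 : E != 0.
  by apply: contra_neq (mulf_neq0 D0 (Fsol0_neq0 k s e)) => E0; rewrite eu E0 mul0r.
have [|w ew] := @Fsol_coprime k i s rk sK rkK e e_neq0 i_gt0 i u v.
  apply: (mulfI E0); rewrite -(Fsol0 k s e).
  transitivity (D * Fsol k s e 0 * Fsol k s e i); first by rewrite eu; ring.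
  by rewrite mulrAC ev; ring.
exists w; apply: (mulIf (Fsol0_neq0 k s e)); rewrite eu ew -(Fsol0 k s e).
by ring.
Qed.
End CommonFactor.

Let base_F : base_forms i F.
Proof.
split.
  split=> [j|]; first by rewrite tnth_mktuple; apply: Fsol_homog; rewrite -ltnS.
  by exists ord0; rewrite tnth_mktuple Fsol0_neq0.
move=> E HE; have [|||u eu] := @divides_Fsol s_down rk_down c s_downK rk_downK c_neq0 1 E.
- exact: oner_neq0.
- by have := HE ord0; rewrite tnth_mktuple mul1r.
- by have := HE ord_max; rewrite tnth_mktuple mul1r.
by apply/unitrPr; exists u.
Qed.

Let base_G : base_forms i G.
Proof.
split.
  split=> [j|]; first by rewrite tnth_mktuple; apply: Fsol_homog; rewrite leq_subr.
  by exists ord_max; rewrite tnth_mktuple subnn Fsol0_neq0.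
move=> E HE; have [|||u eu] := @divides_Fsol s_up rk_up cT s_upK rk_upK cT_neq0 1 E.
- exact: oner_neq0.
- by have := HE ord_max; rewrite tnth_mktuple subnn mul1r.
- by have := HE ord0; rewrite tnth_mktuple subn0 mul1r.
by apply/unitrPr; exists u.
Qed.

(** Up to index i < r the polar system has the weights b + 2a, so the partials are proportional to
    F. Comparing P_0, a multiple of y_0^(r-1), with F_0 = y_0^i gives the common factor. *)
Let partial_F : exists u : k, u != 0 /\ forall j : 'I_i.+1,
  f^`M(inord j) = ((u *: var_down k i 0 ^+ (r - 1 - i)) * tnth F j) \mPo last_vars k r i.
Proof.
have [u [u0 eu]] := @polar_0 k r ltac:(lia).
exists u; split=> // j.
have last_y a : (a <= i)%N -> var_down k i a \mPo last_vars k r i = var_down k r a.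
  move=> le_a; rewrite /var_down comp_mpolyXU -tnth_nth tnth_mktuple.
  by rewrite inordK ?ltnS ?leq_subr //; congr 'X_(inord _); lia.
pose D : R := u *: var_down k i 0 ^+ (r - 1 - i).
pose B b := (D * Fsol k s_down c b) \mPo last_vars k r i.
have B0 : B 0%N = hankel_partial k r 0.
  rewrite /B Fsol0 -[yR k s_down 0]/(var_down k i 0) rmorphM rmorphXn /= comp_mpolyZ.
  rewrite rmorphXn /= last_y // -scalerAl -exprD eu; congr (_ *: _ ^+ _); lia.
have y0 : var_down k r 0 != 0 by apply: (mpolyX_neq0 k).
have P0 : hankel_partial k r 0 != 0.
  by rewrite eu -mul_mpolyC mulf_neq0 ?mpolyC_eq0 ?expf_neq0.
have c0 n : (0 < n <= i)%N -> (c 0 n)%:~R != 0 :> {mpoly k[r.+1]}.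
  by case/andP=> n0 _; apply/mpoly_int_neq0/c_neq0.
have LP n : (0 < n <= i)%N -> lform c (var_down k r) (hankel_partial k r) n = 0.
  move=> le_n; rewrite -[RHS](@lform_polar k r n); last by lia.
  apply: eq_bigr => a _; rewrite /polar_coef subnKC ?ifT //; last by rewrite -ltnS.
  by lia.
have LB n : (0 < n <= i)%N -> lform c (var_down k r) B n = 0.
  move=> le_n.
  transitivity ((D * lform c (var_down k i) (Fsol k s_down c) n) \mPo last_vars k r i).
    rewrite /lform mulr_sumr (rmorph_sum (comp_mpoly (last_vars k r i))).
    apply: eq_bigr => a _; rewrite -last_y; last by have := ltn_ord a; lia.
    by rewrite /B !rmorphM rmorph_int; ring.
  by rewrite lform_Fsol // mulr0 rmorph0.
apply: (mulfI P0); have le_j : (j <= i)%N by rewrite -ltnS.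
have := lform_proportional y0 c0 LB LP le_j; rewrite B0 => ->.
by rewrite tnth_mktuple.
Qed.

Theorem partials_cremona :
  exists (p : 'I_i.+1 -> R) (D : R) (F : (i.+1).-tuple R),
    [/\ (forall j : 'I_i.+1, f^`M(inord j) = p j \mPo last_vars k r i),
        is_gcd p D /\ (forall j, p j = D * tnth F j),
        cremona F,
        [/\ base_forms i F, perfect_of_codim (ideal_gen (tnth F)) 2
          & linear_type (ideal_gen (tnth F))]
      & exists G : (i.+1).-tuple R,
          [/\ inverse_maps F G, base_forms i G,
              perfect_of_codim (ideal_gen (tnth G)) 2
            & linear_type (ideal_gen (tnth G))]].
Proof.
have [u [u0 eu]] := partial_F.
pose D : R := u *: var_down k i 0 ^+ (r - 1 - i).
have D0 : D != 0.
  by rewrite /D -mul_mpolyC mulf_neq0 ?mpolyC_eq0 ?expf_neq0 // (mpolyX_neq0 k).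
exists (fun j => D * tnth F j), D, F; split=> //.
- split=> //; split=> [j|E HE]; first by exists (tnth F j).
  apply: (@divides_Fsol s_down rk_down c s_downK rk_downK c_neq0 D E D0).
    by have := HE ord0; rewrite tnth_mktuple.
  by have := HE ord_max; rewrite tnth_mktuple.
- exists i, i, G; split; [by case: base_F | by case: base_G | exact: FG_inverse].
- split; [exact: base_F | rewrite idealF | rewrite idealF].
    exact: (perfect_Fsol s_downK rk_downK c_neq0 i_gt0).
  exact: (linear_type_Fsol s_downK rk_downK c_neq0).
exists G; split; [exact: FG_inverse | exact: base_G | rewrite idealG | rewrite idealG].
  exact: (perfect_Fsol s_upK rk_upK cT_neq0 i_gt0).
exact: (linear_type_Fsol s_upK rk_upK cT_neq0).
Qed.

End PartialMaps.

Theorem theorem4p4 (k : closedFieldType) (hk : [pchar k] =i pred0)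
    (r : nat) (hr : (2 <= r)%N) :
  let f : {mpoly k[r.+1]} := sub_hankel_det k r in
  [/\ (* (i) *)
      forall i : nat, (1 <= i <= r - 1)%N ->
        exists (p : 'I_i.+1 -> {mpoly k[i.+1]}) (D : {mpoly k[i.+1]})
               (F : (i.+1).-tuple {mpoly k[i.+1]}),
          [/\ (forall j : 'I_i.+1, f^`M(inord j) = p j \mPo last_vars k r i),
              is_gcd p D /\ (forall j, p j = D * tnth F j),
              cremona F,
              [/\ base_forms i F,
                  perfect_of_codim (ideal_gen (tnth F)) 2
                & linear_type (ideal_gen (tnth F))]
            & exists G : (i.+1).-tuple {mpoly k[i.+1]},
                [/\ inverse_maps F G, base_forms i G,
                    perfect_of_codim (ideal_gen (tnth G)) 2
                  & linear_type (ideal_gen (tnth G))]],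
      (* (ii) *)
      linear_part_has_max_rank (tnth (polar_map f)),
      (* (iii) *)
      exists c : k,
        c != 0 /\ hessian f = c *: 'X_ord_max ^+ ((r + 1) * (r - 2))
    & (* (iv) *)
      homaloidal f].
Proof.
move=> f; split.
- by move=> i i_r; apply: partials_cremona.
- exact: polar_linear_part.
- exact: hessian_hankel.
exact: hankel_homaloidal.
Qed.
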